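(* Let $\mathfrak{C}\prec\mathfrak{C}'$ be models of a complete first-order theory $T$, both at least $(\aleph_0+\lambda)^+$-saturated and strongly $(\aleph_0+\lambda)^+$-homogeneous, and let $X$ be a $\emptyset$-type-definable subset of $\mathfrak{C}^\lambda$. Then $F'_{\mathrm{WAP}}$ and $F_{\mathrm{WAP}}$ are compatible, i.e. $r[F'_{\mathrm{WAP}}]=F_{\mathrm{WAP}}$ where $r:S_X(\mathfrak{C}')\to S_X(\mathfrak{C})$ is the restriction map.
   Context: $S_X(\mathfrak{C})$ is the space of complete types over $\mathfrak{C}$ extending the type defining $X$, a flow under $\mathrm{Aut}(\mathfrak{C})$ (pointwise convergence topology). For a flow $(G,Y)$ and $f\in C(Y)$ (continuous real functions), put $(gf)(y)=f(g^{-1}y)$; $f$ is WAP (weakly almost periodic) if $\{gf:g\in G\}$ is relatively compact in the weak topology of the Banach space $C(Y)$ (sup norm); the flow is WAP if every $f\in C(Y)$ is WAP. $F_{\mathrm{WAP}}$ is the finest closed $\mathrm{Aut}(\mathfrak{C})$-invariant equivalence relation on $S_X(\mathfrak{C})$ such that the quotient flow $(\mathrm{Aut}(\mathfrak{C}),S_X(\mathfrak{C})/F_{\mathrm{WAP}})$ is WAP (it exists); $F'_{\mathrm{WAP}}$ is the analogous relation on $S_X(\mathfrak{C}')$ for $\mathrm{Aut}(\mathfrak{C}')$. $r[F']=\{(r(a),r(b)):(a,b)\in F'\}$. *)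

(* Defs.v *)
From HB Require Import structures.
From mathcomp Require Import all_boot all_order all_algebra finmap.
From mathcomp Require Import all_classical all_reals all_analysis.

Set Implicit Arguments.
Unset Strict Implicit.
Unset Printing Implicit Defensive.

Import Order.TTheory GRing.Theory Num.Theory.
Import numFieldNormedType.Exports.

Local Open Scope classical_set_scope.
Local Open Scope ring_scope.
Local Open Scope card_scope.

Record language := Language {
  fsym : Type;
  farity : fsym -> nat;
  rsym : Type;
  rarity : rsym -> nat }.

Inductive term (L : language) (V : Type) : Type :=
| Var of V
| App (f : fsym L) of ('I_(farity f) -> term L V).

(* [formula L V] is the type of first-order formulas whose free variables lie
   in V; a quantifier binds the variable [None] of a formula over [option V].
   L(A)-formulas in the variables V are [formula L (V + A)], and
   L(A)-sentences are [formula L A]. *)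
Inductive formula (L : language) (V : Type) : Type :=
| Eq of term L V & term L V
| Rel (r : rsym L) of ('I_(rarity r) -> term L V)
| Bot
| Imp of formula L V & formula L V
| All of formula L (option V).

Arguments Bot {L V}.

Definition Neg (L : language) (V : Type) (phi : formula L V) := Imp phi Bot.

HB.instance Definition _ (L : language) (V : Type) :=
  gen_eqMixin (formula L V).
HB.instance Definition _ (L : language) (V : Type) :=
  gen_choiceMixin (formula L V).
HB.instance Definition _ (L : language) (V : Type) :=
  isPointed.Build (formula L V) Bot.

Definition sentence (L : language) := formula L void.

Fixpoint trename (L : language) (V W : Type) (h : V -> W) (t : term L V)
    : term L W :=
  match t with
  | Var v => Var L (h v)
  | App f ts => App (fun i => trename h (ts i))
  end.

Fixpoint rename (L : language) (V W : Type) (h : V -> W) (phi : formula L V)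
    {struct phi} : formula L W :=
  match phi with
  | Eq t u => Eq (trename h t) (trename h u)
  | Rel r ts => Rel (fun i => trename h (ts i))
  | Bot => Bot
  | Imp phi psi => Imp (rename h phi) (rename h psi)
  | All phi => All (rename (omap h) phi)
  end.

Record structure (L : language) := Structure {
  carrier :> Type;
  carrier_inhabited : inhabited carrier;
  fint : forall f : fsym L, ('I_(farity f) -> carrier) -> carrier;
  rint : forall r : rsym L, ('I_(rarity r) -> carrier) -> Prop }.

Section semantics.
Context (L : language) (M : structure L).

Fixpoint eval (V : Type) (v : V -> M) (t : term L V) : M :=
  match t with
  | Var x => v x
  | App f ts => fint (fun i => eval v (ts i))
  end.

Definition scons (V : Type) (x : M) (v : V -> M) : option V -> M :=
  fun o => if o is Some y then v y else x.

Fixpoint sat (V : Type) (v : V -> M) (phi : formula L V) {struct phi} : Prop :=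
  match phi with
  | Eq t u => eval v t = eval v u
  | Rel r ts => rint (fun i => eval v (ts i))
  | Bot => False
  | Imp phi psi => sat v phi -> sat v psi
  | All phi => forall x : M, sat (scons x v) phi
  end.

End semantics.

Definition assign (V P T : Type) (a : V -> T) (c : P -> T) (x : V + P) : T :=
  match x with inl i => a i | inr b => c b end.

Definition models (L : language) (M : structure L) (T : set (sentence L)) :=
  forall phi, T phi -> sat (of_void M) phi.

Definition entails (L : language) (T : set (sentence L)) (phi : sentence L) :=
  forall M : structure L, models M T -> sat (of_void M) phi.

Definition complete_theory (L : language) (T : set (sentence L)) :=
  (exists M : structure L, models M T) /\
  forall phi, entails T phi \/ entails T (Neg phi).

Definition elementary (L : language) (M N : structure L) (j : M -> N) :=
  forall phi : formula L M, sat (fun c : M => c) phi <-> sat j phi.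

(* A set p of formulas in the variables V with parameters named by P (via c)
   is finitely satisfiable in M. *)
Definition finsat (L : language) (M : structure L) (V P : Type) (c : P -> M)
    (p : set (formula L (V + P))) :=
  forall q, finite_set q -> q `<=` p ->
    exists a : V -> M, q `<=` [set phi | sat (assign a c) phi].

(* |K|^+-saturation: 1-types over parameter sets A with |A| <= |K|, i.e. of
   cardinality < |K|^+, are realized. *)
Definition succ_saturated (L : language) (M : structure L) (K : Type) :=
  forall A : set M, A #<= [set: K] ->
  forall p : set (formula L (unit + set_type A)),
    finsat (fun c : set_type A => val c) p ->
    exists b : M,
      p `<=` [set phi | sat (assign (fun=> b) (fun c : set_type A => val c)) phi].

Record aut (L : language) (M : structure L) := Aut {
  aut_fun :> M -> M;
  aut_inv : M -> M;
  aut_funK : cancel aut_fun aut_inv;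
  aut_invK : cancel aut_inv aut_fun;
  aut_fint : forall f (x : 'I_(farity f) -> M),
    aut_fun (fint x) = fint (fun i => aut_fun (x i));
  aut_rint : forall r (x : 'I_(rarity r) -> M),
    rint (fun i => aut_fun (x i)) <-> rint x }.

(* Strong |K|^+-homogeneity: every partial elementary map between subsets of
   M, with domain A of cardinality < |K|^+, extends to an automorphism. *)
Definition succ_strongly_homogeneous (L : language) (M : structure L)
    (K : Type) :=
  forall A : set M, A #<= [set: K] ->
  forall f : set_type A -> M,
    (forall phi : formula L (set_type A),
       sat (fun c : set_type A => val c) phi <-> sat f phi) ->
    exists g : aut M, forall c : set_type A, g (val c) = f c.

Section aut_group.
Context (L : language) (M : structure L).
Implicit Types g h : aut M.

Lemma aut_eq g h : (forall x, g x = h x) -> g = h.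
Proof.
case: g h => [g g' gK g'K gf gr] [h h' hK h'K hf hr] /= gh.
have {}gh : g = h by apply/funext.
subst h; have gh' : g' = h'.
  by apply/funext => x; apply: (can_inj gK); rewrite g'K h'K.
by subst h'; congr Aut; exact: Prop_irrelevance.
Qed.

Definition aut_id : aut M.
Proof. by exists id id. Defined.

Definition aut_mul g h : aut M.
Proof.
exists (fun x => g (h x)) (fun x => aut_inv h (aut_inv g x)).
- by move=> x; rewrite !aut_funK.
- by move=> x; rewrite !aut_invK.
- by move=> f x; rewrite !aut_fint.
- by move=> r x; rewrite !aut_rint.
Defined.

Definition aut_opp g : aut M.
Proof.
exists (aut_inv g) g.
- exact: aut_invK.
- exact: aut_funK.
- move=> f x; apply: (can_inj (aut_funK g)); rewrite aut_invK aut_fint.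
  by congr fint; apply/funext => i; rewrite aut_invK.
- move=> r x; rewrite -(aut_rint g).
  by under eq_fun do rewrite aut_invK.
Defined.

Lemma aut_mulA : associative aut_mul. Proof. by move=> f g h; exact: aut_eq. Qed.
Lemma aut_mul1 : left_id aut_id aut_mul. Proof. by move=> f; exact: aut_eq. Qed.
Lemma aut_mulr1 : right_id aut_id aut_mul. Proof. by move=> f; exact: aut_eq. Qed.
Lemma aut_mulV : left_inverse aut_id aut_opp aut_mul.
Proof. by move=> f; apply: aut_eq => x /=; rewrite aut_funK. Qed.
Lemma aut_mulrV : right_inverse aut_id aut_opp aut_mul.
Proof. by move=> f; apply: aut_eq => x /=; rewrite aut_invK. Qed.

HB.instance Definition _ := gen_eqMixin (aut M).
HB.instance Definition _ := gen_choiceMixin (aut M).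
HB.instance Definition _ := isGroup.Build (aut M)
  aut_mulA aut_mul1 aut_mulr1 aut_mulV aut_mulrV.

End aut_group.

Section sat_facts.
Context (L : language).

Lemma trename_id (V : Type) (t : term L V) : trename id t = t.
Proof. by elim: t => //= f ts IH; congr App; apply/funext. Qed.

Lemma trename_comp (V W Z : Type) (h : V -> W) (k : W -> Z) (t : term L V) :
  trename k (trename h t) = trename (k \o h) t.
Proof. by elim: t => //= f ts IH; congr App; apply/funext. Qed.

Lemma rename_id (V : Type) (phi : formula L V) : rename id phi = phi.
Proof.
elim: phi => //= {V} [V t u|V r ts|V phi -> psi -> //|V phi IH].
- by rewrite !trename_id.
- by congr Rel; apply/funext => i; rewrite trename_id.
- by rewrite (_ : omap id = id) ?IH//; apply/funext => -[].
Qed.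

Lemma rename_comp (V W Z : Type) (h : V -> W) (k : W -> Z) (phi : formula L V) :
  rename k (rename h phi) = rename (k \o h) phi.
Proof.
elim: phi W Z h k => //= {V} [V t u|V r ts|V phi IH psi IH'|V phi IH] W Z h k.
- by rewrite !trename_comp.
- by congr Rel; apply/funext => i; rewrite trename_comp.
- by rewrite IH IH'.
- by rewrite IH; congr All; congr rename; apply/funext => -[].
Qed.

Lemma eval_rename (M : structure L) (V W : Type) (h : V -> W) (v : W -> M)
  (t : term L V) : eval v (trename h t) = eval (v \o h) t.
Proof. by elim: t => //= f ts IH; congr fint; apply/funext. Qed.

Lemma sat_rename (M : structure L) (V W : Type) (h : V -> W) (v : W -> M)
  (phi : formula L V) : sat v (rename h phi) <-> sat (v \o h) phi.
Proof.
elim: phi W h v => //= {V} [V t u|V r ts|V phi IH psi IH'|V phi IH] W h v.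
- by rewrite !eval_rename.
- by under eq_fun do rewrite eval_rename.
- by rewrite IH IH'.
- have E x : scons x v \o omap h = scons x (v \o h) by apply/funext => -[].
  by split=> H x; move: (H x); rewrite IH E.
Qed.

Lemma eval_aut (M : structure L) (g : aut M) (V : Type) (v : V -> M)
  (t : term L V) : eval (g \o v) t = g (eval v t).
Proof.
by elim: t => //= f ts IH; rewrite aut_fint; congr fint; apply/funext.
Qed.

Lemma sat_aut (M : structure L) (g : aut M) (V : Type) (v : V -> M)
  (phi : formula L V) : sat (g \o v) phi <-> sat v phi.
Proof.
elim: phi v => //= {V} [V t u|V r ts|V phi IH psi IH'|V phi IH] v.
- by rewrite !eval_aut; split=> [/(can_inj (aut_funK g))|->].
- by under eq_fun do rewrite eval_aut; exact: aut_rint.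
- by rewrite IH IH'.
- have E x : g \o scons x v = scons (g x) (g \o v) by apply/funext => -[].
  split=> H x; first by rewrite -IH E; exact: H.
  by rewrite -(aut_invK g x) -E IH; exact: H.
Qed.

Lemma eval_support (M : structure L) (V : Type) (t : term L V) :
  exists s : set V, finite_set s /\
    forall v w : V -> M, (forall x, s x -> v x = w x) -> eval v t = eval w t.
Proof.
elim: t => [x|f ts IH] /=.
  by exists [set x]; split=> [|v w]; [exact: finite_set1|exact].
have [s sP] := choice IH.
exists (\bigcup_i s i); split.
  by apply: bigcup_finite => // i _; have [] := sP i.
move=> v w vw; congr fint; apply/funext => i; have [_] := sP i; apply=> x sx.
by apply: vw; exists i.
Qed.

Lemma sat_support (M : structure L) (V : Type) (phi : formula L V) :
  exists s : set V, finite_set s /\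
    forall v w : V -> M, (forall x, s x -> v x = w x) ->
      sat v phi <-> sat w phi.
Proof.
elim: phi => {V} [V t u|V r ts|V|V phi [s [fs sP]] psi [s' [fs' sP']]|
    V phi [s [fs sP]]] /=.
- have [s [fs sP]] := eval_support M t; have [s' [fs' sP']] := eval_support M u.
  exists (s `|` s'); split; first by rewrite finite_setU.
  move=> v w vw; rewrite (sP v w) ?(sP' v w) //.
    by move=> x ?; apply: vw; right.
  by move=> x ?; apply: vw; left.
- have [s sP] := choice (fun i => eval_support M (ts i)).
  exists (\bigcup_i s i); split.
    by apply: bigcup_finite => // i _; have [] := sP i.
  move=> v w vw; rewrite (_ : (fun i => eval v _) = fun i => eval w (ts i)) //.
  apply/funext => i; have [_] := sP i; apply=> x sx.
  by apply: vw; exists i.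
- by exists set0; split.
- exists (s `|` s'); split; first by rewrite finite_setU.
  move=> v w vw; rewrite (sP v w) ?(sP' v w) //.
    by move=> x ?; apply: vw; right.
  by move=> x ?; apply: vw; left.
- exists (Some @^-1` s); split.
    by apply: finite_preimage => // x y _ _ [].
  move=> v w vw.
  have E x : sat (scons x v) phi <-> sat (scons x w) phi.
    by apply: sP => -[y|] //= sy; exact: vw.
  by split=> H x; apply/E; exact: H.
Qed.

Definition Ex (V : Type) (phi : formula L (option V)) := Neg (All (Neg phi)).

Lemma sat_Ex (M : structure L) (V : Type) (v : V -> M) phi :
  sat v (Ex phi) <-> exists x, sat (scons x v) phi.
Proof.
rewrite /=; split=> [H|[x Hx] /(_ x)]; last exact.
by apply: contrapT => /forallNP.
Qed.

Definition exists_var (V : Type) (x : V) (phi : formula L V) :=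
  Ex (rename (fun y => if `[< y = x >] then None else Some y) phi).

Lemma sat_exists_var (M : structure L) (V : Type) (v : V -> M) x phi :
  sat v (exists_var x phi) <->
  exists w : V -> M, (forall y, y <> x -> w y = v y) /\ sat w phi.
Proof.
rewrite sat_Ex; split=> [[b]|[w [wv wphi]]].
  rewrite sat_rename => H; eexists; split; last exact: H.
  by move=> y yx /=; case: asboolP.
exists (w x); rewrite sat_rename; congr (sat _ phi): wphi.
by apply/funext => y /=; case: asboolP => [->//|/= /wv].
Qed.

Lemma sat_exists_vars (M : structure L) (N : structure L) (j : M -> N)
    (V : Type) (phi : formula L V) (v : V -> M) (w : V -> N) (s : set V) :
  elementary j -> finite_set s -> (forall x, ~ s x -> w x = j (v x)) ->
  sat w phi ->
  exists u : V -> M, (forall x, ~ s x -> u x = v x) /\ sat u phi.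
Proof.
move=> jel [n].
elim: n s phi w => [s phi w|n IH s phi w].
  rewrite II0 card_eq0 => /eqP -> wv wphi; exists v; split => //.
  have : sat j (rename v phi).
    rewrite sat_rename (_ : j \o v = w) //.
    by apply/funext => x /=; rewrite wv.
  by rewrite -jel sat_rename.
move=> /eq_cardSP [x sx sxn] wv wphi.
pose w' : V -> N := fun y => if `[< y = x >] then j (v x) else w y.
have [||u [uv]] := IH _ (exists_var x phi) w' sxn.
- move=> y sy; rewrite /w'; case: asboolP => [->//|yx].
  by apply: wv => sy'; apply: sy; split.
- rewrite sat_exists_var; exists w; split => // y yx.
  by rewrite /w'; case: asboolP.
rewrite sat_exists_var => -[u' [u'u u'phi]].
exists u'; split => // y sy; rewrite u'u; last by move=> yx; apply: sy; rewrite yx.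
by apply: uv => -[].
Qed.

Definition And (V : Type) (phi psi : formula L V) := Neg (Imp phi (Neg psi)).

Lemma sat_And (M : structure L) (V : Type) (v : V -> M) phi psi :
  sat v (And phi psi) <-> sat v phi /\ sat v psi.
Proof.
rewrite /=; split=> [H|[? ?]]; last exact.
by split; apply: contrapT => nH; apply: H.
Qed.

Lemma finite_conj (V : Type) (q : set (formula L V)) : finite_set q ->
  exists phi, forall (M : structure L) (v : V -> M),
    sat v phi <-> q `<=` [set psi | sat v psi].
Proof.
case=> n; elim: n q => [q|n IH q /eq_cardSP[phi qphi]].
  by rewrite II0 card_eq0 => /eqP ->; exists (Neg Bot) => M v; split=> [_ psi|_] [].
move=> /IH[psi psiP]; exists (And phi psi) => M v; rewrite sat_And psiP.
split=> [[vphi H] chi qchi|H].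
  by have [->//|cp] := pselect (chi = phi); apply: H; split.
by split; [exact: H|move=> chi [/H]].
Qed.

End sat_facts.

(* The index type I plays the role of lambda; pi is a partial type over the
   empty set in the variables (x_i), i in I, and X = pi(M). *)
Definition type_defines (L : language) (M : structure L) (I : Type)
    (pi : set (formula L I)) (X : set (I -> M)) :=
  X = [set a | forall phi, pi phi -> sat a phi].

Record type_space (L : language) (M : structure L) (I : Type)
    (pi : set (formula L I)) := TypeSpace {
  type_set :> formula L (I + M) -> Prop;
  type_finsat : finsat (fun c : M => c) type_set;
  type_complete : forall phi, type_set phi \/ type_set (Neg phi);
  type_extends : forall phi, pi phi -> type_set (rename inl phi) }.

Section type_space_facts.
Context (L : language) (M : structure L) (I : Type) (pi : set (formula L I)).

Lemma type_space_eq (p q : type_space M pi) :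
  (forall phi, p phi <-> q phi) -> p = q.
Proof.
case: p q => [p p1 p2 p3] [q q1 q2 q3] /= pq.
have {}pq : p = q by apply/seteqP; split=> phi /pq.
by subst q; congr TypeSpace; exact: Prop_irrelevance.
Qed.

HB.instance Definition _ := gen_eqMixin (type_space M pi).
HB.instance Definition _ := gen_choiceMixin (type_space M pi).
(* The Stone topology: the sets [phi] = {p | phi in p} form a subbase. *)
HB.instance Definition _ := isSubBaseTopological.Build (type_space M pi)
  [set: formula L (I + M)] (fun phi => [set p : type_space M pi | p phi]).

Definition inr_map (I P Q : Type) (h : P -> Q) (x : I + P) : I + Q :=
  match x with inl i => inl i | inr c => inr (h c) end.

(* phi(x, c) belongs to g p iff phi(x, g^-1 c) belongs to p. *)
Definition type_act (g : aut M) (p : type_space M pi) : type_space M pi.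
Proof.
exists [set phi | p (rename (inr_map (aut_inv g)) phi)].
- move=> q qfin qp.
  have [||a aq] := @type_finsat _ _ _ _ p (rename (inr_map (aut_inv g)) @` q).
  + exact: finite_image.
  + by move=> _ [phi qphi <-]; exact: qp.
  exists (g \o a) => phi qphi /=.
  have /= : sat (assign a (fun c => c)) (rename (inr_map (aut_inv g)) phi).
    by apply: aq; exists phi.
  rewrite sat_rename -(sat_aut g); congr (sat _ phi); apply/funext.
  by case=> //= c; rewrite aut_invK.
- by move=> phi; exact: (type_complete p (rename _ phi)).
- by move=> phi /type_extends /=; rewrite rename_comp; exact.
Defined.

End type_space_facts.

Definition type_restr (L : language) (M N : structure L) (j : M -> N)
    (jel : elementary j) (I : Type) (pi : set (formula L I))
    (p : type_space N pi) : type_space M pi.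
Proof.
exists [set phi | p (rename (inr_map j) phi)].
- move=> q qfin qp.
  have [||a aq] := @type_finsat _ _ _ _ p (rename (inr_map j) @` q).
  + exact: finite_image.
  + by move=> _ [phi qphi <-]; exact: qp.
  have [Phi PhiP] := finite_conj qfin.
  pose w := assign a (fun c : N => c) \o inr_map j.
  have wPhi : sat w Phi.
    apply/PhiP => phi qphi /=; rewrite /w -sat_rename; apply: aq.
    by exists phi.
  have [s [sfin sP]] := sat_support N Phi.
  have [m] := carrier_inhabited M.
  pose v : I + M -> M := assign (fun=> m) id.
  pose s' := s `&` range inl.
  pose w' x := if `[< s' x >] then w x else j (v x).
  have [|||u [uv uPhi]] := @sat_exists_vars _ _ _ j _ Phi v w' s' jel.
  + exact: finite_setIl.
  + by move=> x sx; rewrite /w'; case: asboolP.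
  + rewrite (sP w' w) // => x sx; rewrite /w'; case: asboolP => //.
    by case: x sx => [i|c] //= sx []; split => //; exists i.
  exists (u \o inl) => phi qphi /=; move/PhiP: uPhi => /(_ _ qphi) /=.
  congr (sat _ phi); apply/funext => -[//|c /=].
  by apply: uv => -[_ []].
- by move=> phi; exact: (type_complete p (rename _ phi)).
- by move=> phi /type_extends /=; rewrite rename_comp; exact.
Defined.

(* Weak almost periodicity involves no topology on G, so only an action of the
   abstract group by homeomorphisms is recorded; compactness and separation of
   Y are properties of the flows considered, not fields. *)
Record flow (G : groupType) (Y : topologicalType) := Flow {
  flow_act :> G -> Y -> Y;
  flow_act1 : forall y, flow_act 1%g y = y;
  flow_actM : forall g h y, flow_act (g * h)%g y = flow_act g (flow_act h y);
  flow_continuous : forall g, continuous (flow_act g) }.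

Section continuous_functions.
Context (R : realType) (Y : topologicalType).
Local Notation CY := (continuousType Y R).

Lemma cts_add_subproof (f g : CY) : continuous (fun y => f y + g y).
Proof.
by move=> y; exact: (continuousD (@cts_fun _ _ f y) (@cts_fun _ _ g y)).
Qed.
Lemma cts_opp_subproof (f : CY) : continuous (fun y => - f y).
Proof. by move=> y; exact: (continuousN (@cts_fun _ _ f y)). Qed.
Lemma cts_scale_subproof (a : R) (f : CY) : continuous (fun y => a * f y).
Proof.
by move=> y; exact: (continuousM (@cst_continuous _ _ a y) (@cts_fun _ _ f y)).
Qed.

Definition cts_zero : CY := cst 0.
Definition cts_add (f g : CY) : CY := mkcts (@cts_add_subproof f g).
Definition cts_opp (f : CY) : CY := mkcts (@cts_opp_subproof f).
Definition cts_scale (a : R) (f : CY) : CY := mkcts (@cts_scale_subproof a f).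

Lemma cts_addA : associative cts_add.
Proof. by move=> f g h; apply/continuousEP => y; exact: addrA. Qed.
Lemma cts_addC : commutative cts_add.
Proof. by move=> f g; apply/continuousEP => y; exact: addrC. Qed.
Lemma cts_add0 : left_id cts_zero cts_add.
Proof. by move=> f; apply/continuousEP => y; exact: add0r. Qed.
Lemma cts_addN : left_inverse cts_zero cts_opp cts_add.
Proof. by move=> f; apply/continuousEP => y; exact: addNr. Qed.

HB.instance Definition _ :=
  GRing.isZmodule.Build CY cts_addA cts_addC cts_add0 cts_addN.

Lemma cts_scaleA a b (f : CY) : cts_scale a (cts_scale b f) = cts_scale (a * b) f.
Proof. by apply/continuousEP => y; exact: mulrA. Qed.
Lemma cts_scale1 : left_id 1 cts_scale.
Proof. by move=> f; apply/continuousEP => y; exact: mul1r. Qed.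
Lemma cts_scaleDr : right_distributive cts_scale +%R.
Proof. by move=> a f g; apply/continuousEP => y; exact: mulrDr. Qed.
Lemma cts_scaleDl (f : CY) : {morph cts_scale^~ f : a b / a + b}.
Proof. by move=> a b; apply/continuousEP => y; exact: mulrDl. Qed.

HB.instance Definition _ := GRing.Zmodule_isLmodule.Build R CY
  cts_scaleA cts_scale1 cts_scaleDr cts_scaleDl.

Definition supnorm (f : CY) : R := sup (range (fun y => `|f y|)).

(* The topological dual of (C(Y), supnorm). *)
Record cts_dual := CtsDual {
  dual_fun :> {linear CY -> R^o};
  dual_bounded : exists K : R, forall f : CY, `|dual_fun f| <= K * supnorm f }.

(* C(Y) with its weak topology, i.e. the initial topology for the family of
   all elements of the dual.  This is a copy of [continuousType Y R], whose
   own topology in the library is a different one. *)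
Definition weak_C : Type :=
  initial_topology ((fun f u => u f) : CY -> {ptws cts_dual -> R^o}).

HB.instance Definition _ := Topological.on weak_C.

End continuous_functions.

Section wap.
Context (R : realType) (G : groupType) (Y : topologicalType).
Implicit Types phi : flow G Y.

Lemma translate_subproof phi (g : G) (f : continuousType Y R) :
  continuous (fun y => f (phi (g^-1)%g y)).
Proof.
move=> y; apply: (@continuous_comp _ _ _ (phi (g^-1)%g) f).
  exact: flow_continuous.
exact: cts_fun.
Qed.

Definition translate phi (g : G) (f : continuousType Y R) :
  continuousType Y R := mkcts (@translate_subproof phi g f).

Definition wap_fun phi (f : continuousType Y R) :=
  precompact (range (fun g => translate phi g f : weak_C R Y)).

Definition wap_flow phi := forall f : continuousType Y R, wap_fun phi f.

End wap.

Section quotient_flow.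
Context (G : groupType) (Y : topologicalType) (phi : flow G Y).
Local Open Scope quotient_scope.

Definition invariant_rel (F : equiv_rel Y) :=
  forall g x y, F x y -> F (phi g x) (phi g y).

Context (F : equiv_rel Y) (Finv : invariant_rel F).
Local Notation Q := (quotient_topology {eq_quot F}).

Definition quotient_act (g : G) (x : Q) : Q := \pi_Q (phi g (repr x)).

Lemma quotient_act_pi g y : quotient_act g (\pi_Q y) = \pi_Q (phi g y).
Proof.
suff E : \pi_{eq_quot F} (phi g (repr (\pi_Q y))) = \pi_{eq_quot F} (phi g y).
  exact: E.
apply/eqmodP/Finv; apply/eqmodP; exact: (@reprK _ Q (\pi_Q y)).
Qed.

Lemma quotient_act1 x : quotient_act 1%g x = x.
Proof. by rewrite -[x]reprK quotient_act_pi flow_act1. Qed.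

Lemma quotient_actM g h x :
  quotient_act (g * h)%g x = quotient_act g (quotient_act h x).
Proof.
have <- : \pi_Q (repr x) = x by exact: reprK.
by rewrite quotient_act_pi (quotient_act_pi h) quotient_act_pi flow_actM.
Qed.

Lemma quotient_act_continuous g : continuous (quotient_act g).
Proof.
apply/quotient_continuous.
rewrite (_ : _ \o _ = \pi_Q \o phi g).
  move=> y; apply: continuous_comp; first exact: flow_continuous.
  exact: pi_continuous.
by apply/funext => y /=; rewrite quotient_act_pi.
Qed.

Definition quotient_flow : flow G Q :=
  Flow quotient_act1 quotient_actM quotient_act_continuous.

End quotient_flow.

Definition wap_quotient_rel (R : realType) (G : groupType)
    (Y : topologicalType) (phi : flow G Y) (F : equiv_rel Y) :=
  closed [set xy : Y * Y | F xy.1 xy.2] /\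
  exists Finv : invariant_rel phi F, wap_flow R (quotient_flow Finv).

Definition is_F_WAP (R : realType) (G : groupType)
    (Y : topologicalType) (phi : flow G Y) (F : equiv_rel Y) :=
  wap_quotient_rel R phi F /\
  forall E : equiv_rel Y, wap_quotient_rel R phi E ->
    forall x y, F x y -> E x y.

Section type_flow.
Context (L : language) (M : structure L) (I : Type) (pi : set (formula L I)).

Lemma type_act1 (p : type_space M pi) : type_act 1%g p = p.
Proof.
apply: type_space_eq => phi /=.
by rewrite (_ : inr_map _ = id) ?rename_id//; apply/funext => -[].
Qed.

Lemma type_actM (g h : aut M) (p : type_space M pi) :
  type_act (g * h)%g p = type_act g (type_act h p).
Proof.
apply: type_space_eq => phi /=; rewrite rename_comp.
by rewrite (_ : _ \o _ = inr_map (aut_inv (g * h)%g))//; apply/funext => -[].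
Qed.

Lemma type_act_continuous (g : aut M) : continuous (@type_act L M I pi g).
Proof.
apply/continuousP => A [D DI <-]; rewrite preimage_bigcup.
exists [set @type_act L M I pi g @^-1` B | B in D]; last first.
  by rewrite bigcup_image.
move=> _ [B /DI[S _ <-] <-].
exists [fset rename (inr_map (aut_inv g)) psi | psi in S]%fset.
  by move=> ? _; rewrite inE.
apply/seteqP; split=> [p pS psi psiS|p pS _ /imfsetP[psi psiS ->]].
  by apply: pS => /=; apply/imfsetP; exists psi.
exact: pS.
Qed.

Definition type_flow : flow (aut M) (type_space M pi) :=
  Flow type_act1 type_actM type_act_continuous.

End type_flow.

(* Main.v *)
(** Relative weak compactness of an orbit in [C(Y)] is equivalent to a condition
    on sequences of translates, in the spirit of James: the convex hulls of some
    initial segment and of the corresponding tail come uniformly close to each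
    other.  Mazur's theorem gives one implication, and an ultrafilter argument
    the other.  The condition involves countably many translates, and a
    continuous function on a type space countably many parameters, so both can
    be moved between [C'] and [C] by saturation and homogeneity.

    Let [D] be the closure in [S_X(C')] of the types of the tuples of [X(C)]; it
    maps onto [S_X(C)].  A continuous function [k] on [S_X(C')/F'] has a weak
    limit of translates that agrees with [k] on [D] and factors through [r],
    since the parameters of [k] can be moved into [C].  Hence elements of [D]
    with the same restriction are [F']-equivalent, [S_X(C)] maps continuously to
    [S_X(C')/F'], and the kernel of that map is a WAP relation contained in
    [r[F']]; so [F] is contained in [r[F']].  Conversely the relation
    "[r(s p) F r(s q)] for all [s] in [Aut(C')]" is closed and invariant, and
    its quotient is WAP because a continuous function on it is, after
    translation, [f o r] with [f] continuous on [S_X(C)/F]; so [r[F']] is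
    contained in [F]. *)
Require Import Defs.
From HB Require Import structures.
From mathcomp Require Import all_boot all_order all_algebra finmap.
From mathcomp Require Import all_classical all_reals all_analysis.
From mathcomp Require Import ring lra.

Set Implicit Arguments.
Unset Strict Implicit.
Unset Printing Implicit Defensive.

Import Order.TTheory GRing.Theory Num.Theory.
Import numFieldNormedType.Exports.

Local Open Scope classical_set_scope.
Local Open Scope ring_scope.

(** * Convex hulls and sublinear functionals *)

Section convex_hull.
Context (R : realDomainType) (V : lmodType R).
Implicit Types A B : set V.

Lemma convex_setP A : @convex_set R V A <->
  forall x y (t : R), 0 <= t <= 1 -> A x -> A y -> A (t *: x + (1 - t) *: y).
Proof.
split=> [Ac x y t /andP[t0 t1] Ax Ay|Ac x y t /set_mem Ax /set_mem Ay].
  by apply: set_mem; apply: (Ac x y (Itv01 t0 t1)); exact: mem_set.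
by apply: mem_set; apply: Ac; rewrite ?ge0 ?le1.
Qed.

Definition conv_hull A : set V := smallest (@convex_set R V) A.

Lemma conv_hull_sub A B : A `<=` B -> @convex_set R V B -> conv_hull A `<=` B.
Proof. by move=> AB Bc; exact: smallest_sub. Qed.

Lemma conv_hull_convex A : @convex_set R V (conv_hull A).
Proof.
apply/convex_setP => x y t t01 Ax Ay B [Bc AB].
by move/convex_setP: (Bc); apply=> //; [exact: Ax|exact: Ay].
Qed.

Lemma conv_hull_mono A B : A `<=` B -> conv_hull A `<=` conv_hull B.
Proof. by apply: sub_smallest2r; exact: conv_hull_convex. Qed.

Lemma conv_hull_range (h : nat -> V) c : conv_hull (range h) c ->
  exists m, conv_hull (h @` `I_m) c.
Proof.
pose B := [set c | exists m, conv_hull (h @` `I_m) c].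
have hull_le m n : (m <= n)%N ->
    conv_hull (h @` `I_m) `<=` conv_hull (h @` `I_n).
  move=> mn; apply: conv_hull_mono.
  by apply: image_subset => k /leq_trans; exact.
apply: (@conv_hull_sub _ B).
  by move=> _ [k _ <-]; exists k.+1; apply: sub_gen_smallest; exists k => /=.
apply/convex_setP => x y t t01 [m xm] [n yn]; exists (maxn m n).
have /convex_setP := @conv_hull_convex (h @` `I_(maxn m n)); apply=> //.
  by apply: hull_le xm; exact: leq_maxl.
by apply: hull_le yn; exact: leq_maxr.
Qed.

Lemma convex_set1 x : @convex_set R V [set x].
Proof.
by apply/convex_setP => _ _ t _ -> ->; rewrite -scalerDl addrC subrK scale1r.
Qed.

Lemma convex_set_translate A a : @convex_set R V A ->
  @convex_set R V [set x - a | x in A].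
Proof.
move=> /convex_setP Ac; apply/convex_setP => _ _ t t01 [x Ax <-] [y Ay <-].
exists (t *: x + (1 - t) *: y); first exact: Ac.
by rewrite !scalerBr addrACA -opprD -scalerDl [t + _]addrC subrK scale1r.
Qed.

Lemma convex_set_strip (u : {linear V -> R^o}) (a d : R) :
  @convex_set R V [set x | `|u x - a| <= d].
Proof.
apply/convex_setP => x y t /andP[t0 t1] /=.
rewrite linearD !linearZ /= !ler_norml => /andP[x1 x2] /andP[y1 y2].
by rewrite -![_ *: u _]/(_ * u _); apply/andP; split; nra.
Qed.

End convex_hull.

Lemma convex_set_weighted_mean (R : realFieldType) (V : lmodType R)
    (D : set V) (t s : R) d e : @convex_set R V D -> 0 <= t -> 0 <= s ->
  D d -> D e -> exists2 c, D c & t *: d + s *: e = (t + s) *: c.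
Proof.
move=> /convex_setP D_convex t0 s0 Dd De.
have [ts0|ts_neq0] := eqVneq (t + s) 0.
  have [-> ->] : t = 0 /\ s = 0 by split; lra.
  by exists d; rewrite // addr0 !scale0r addr0.
have ts_gt0 : 0 < t + s by rewrite lt_def ts_neq0 addr_ge0.
exists ((t / (t + s)) *: d + (1 - t / (t + s)) *: e).
  apply: D_convex => //.
  by rewrite divr_ge0 ?addr_ge0//= ler_pdivrMr// mul1r lerDl.
by rewrite scalerDr !scalerA; congr (_ *: _ + _ *: _); field.
Qed.

Section sublinear.
Context (R : realType) (V : lmodType R).
Implicit Types (p q : V -> R) (D : set V) (b : R).

Definition sublinear q := (forall x y, q (x + y) <= q x + q y) /\
  forall (t : R) x, 0 < t -> q (t *: x) <= t * q x.

Lemma sublinear0 q : sublinear q -> q 0 = 0.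
Proof.
by move=> [_ qZ]; have := qZ 2 0; have := qZ 2^-1 0; rewrite !scaler0; lra.
Qed.

Lemma sublinear_oppl q x : sublinear q -> - q (- x) <= q x.
Proof.
by move=> q_sub; have := (q_sub.1 x (- x)); rewrite subrr sublinear0//; lra.
Qed.

Lemma sublinearZ q (t : R) x : sublinear q -> 0 <= t -> q (t *: x) = t * q x.
Proof.
move=> q_sub; rewrite le_eqVlt => /orP[/eqP<-|t0].
  by rewrite scale0r mul0r sublinear0.
apply/eqP; rewrite eq_le q_sub.2//=.
have ti : 0 < t^-1 by rewrite invr_gt0.
have := q_sub.2 t^-1 (t *: x) ti.
by rewrite scalerA mulVf ?gt_eqF// scale1r mulrC ler_pdivlMr// mulrC.
Qed.

(* The largest sublinear functional below [p] that is at most [- b] on [- D]. *)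
Definition sublinear_push p D b (x : V) : R :=
  inf [set y | exists (t : R) d, [/\ 0 <= t, D d & y = p (x + t *: d) - t * b]].

Section sublinear_push.
Context (p : V -> R) (D : set V) (b : R).
Hypotheses (p_sublinear : sublinear p) (D0 : D !=set0)
  (D_convex : @convex_set R V D) (b_le : forall d, D d -> b <= p d).
Local Notation q := (sublinear_push p D b).

Lemma sublinear_push_le x (t : R) d : 0 <= t -> D d ->
  q x <= p (x + t *: d) - t * b.
Proof.
move=> t0 Dd; apply: ge_inf; last by exists t, d.
exists (- p (- x)) => _ {t d t0 Dd} [t [d [t0 Dd ->]]].
have := p_sublinear.1 (x + t *: d) (- x).
rewrite addrAC subrr add0r sublinearZ//.
by have := b_le Dd => /(ler_wpM2l t0); lra.
Qed.

Lemma le_sublinear_push x z :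
  (forall (t : R) d, 0 <= t -> D d -> z <= p (x + t *: d) - t * b) -> z <= q x.
Proof.
move=> zle; apply: lb_le_inf; last by move=> _ [t [d [t0 Dd ->]]]; exact: zle.
by have [d Dd] := D0; exists (p (x + 0 *: d) - 0 * b), 0, d.
Qed.

Lemma sublinear_push_le_self x : q x <= p x.
Proof.
have [d Dd] := D0; have := @sublinear_push_le x 0 d (lexx _) Dd.
by rewrite scale0r addr0 mul0r subr0.
Qed.

Lemma sublinear_push_opp d : D d -> q (- d) <= - b.
Proof.
move=> Dd; have := @sublinear_push_le (- d) 1 d ler01 Dd.
by rewrite scale1r addNr sublinear0// mul1r sub0r.
Qed.

Lemma sublinear_push_sublinear : sublinear q.
Proof.
split=> [x y|t x t0].
  rewrite -lerBlDr; apply: le_sublinear_push => t d t0 Dd.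
  rewrite lerBlDr [leRHS]addrC -lerBlDr.
  apply: le_sublinear_push => s e s0 De; rewrite lerBlDr.
  have [c Dc tsE] := convex_set_weighted_mean D_convex t0 s0 Dd De.
  apply: (le_trans (sublinear_push_le _ (addr_ge0 t0 s0) Dc)).
  rewrite -tsE addrACA.
  by have := p_sublinear.1 (x + t *: d) (y + s *: e); lra.
rewrite -ler_pdivrMl//; apply: le_sublinear_push => s d s0 Dd.
rewrite ler_pdivrMl//.
have ts : 0 <= t * s by rewrite mulr_ge0// ltW.
apply: (le_trans (sublinear_push_le _ ts Dd)).
rewrite -scalerA -scalerDr sublinearZ//; last exact: ltW.
by rewrite mulrBr mulrA.
Qed.

End sublinear_push.

Lemma sublinear_chain_inf (A : set (V -> R)) p : A !=set0 ->
  (forall q, A q -> sublinear q) -> (forall q x, A q -> q x <= p x) ->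
  total_on A (fun q q' => forall x, q' x <= q x) ->
  exists2 m, sublinear m & forall q x, A q -> m x <= q x.
Proof.
move=> [q0 Aq0] Asub Ap Atot; pose m x := inf [set q x | q in A].
have m_le q x : A q -> m x <= q x.
  move=> Aq; apply: ge_inf; last by exists q.
  exists (- p (- x)) => _ [q' Aq' <-].
  by have := sublinear_oppl x (Asub _ Aq'); have := Ap _ (- x) Aq'; lra.
have le_m z x : (forall q, A q -> z <= q x) -> z <= m x.
  move=> zle; apply: lb_le_inf; first by exists (q0 x), q0.
  by move=> _ [q Aq <-]; exact: zle.
exists m => //; split=> [x y|t x t0].
  rewrite -lerBlDr; apply: (le_m) => q Aq.
  rewrite lerBlDr [leRHS]addrC -lerBlDr; apply: (le_m) => q' Aq'.
  rewrite lerBlDr.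
  have [q'q|qq'] := Atot _ _ Aq Aq'.
    have := m_le _ (x + y) Aq'; have := (Asub _ Aq').1 x y; have := q'q x; lra.
  have := m_le _ (x + y) Aq; have := (Asub _ Aq).1 x y; have := qq' y; lra.
rewrite -ler_pdivrMl//; apply: (le_m) => q Aq; rewrite ler_pdivrMl//.
exact: le_trans (m_le _ _ Aq) ((Asub _ Aq).2 _ _ t0).
Qed.

Definition minimal_sublinear q := sublinear q /\
  forall q', sublinear q' -> (forall x, q' x <= q x) -> q' = q.

Lemma minimal_sublinear_below p : sublinear p ->
  exists2 q, minimal_sublinear q & forall x, q x <= p x.
Proof.
move=> p_sub; pose P q := sublinear q /\ forall x, q x <= p x.
pose r (a b : {q | P q}) := `[< forall x, sval b x <= sval a x >].
have [||||[q [q_sub qp]] qmin] := @Zorn _ r.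
- by move=> a; apply/asboolP => x.
- move=> a b c /asboolP ba /asboolP cb; apply/asboolP => x.
  exact: le_trans (cb x) (ba x).
- move=> [a aP] [b bP] /asboolP/= ba /asboolP/= ab; apply: eq_exist.
  by apply/funext => x; apply/eqP; rewrite eq_le ab ba.
- move=> A Atot; have [->|/set0P[a0 Aa0]] := eqVneq A set0.
    by exists (exist P p (conj p_sub (fun=> lexx _))).
  have [||||m m_sub m_le] := @sublinear_chain_inf [set sval a | a in A] p.
  + by exists (sval a0), a0.
  + by move=> _ [a _ <-]; exact: (svalP a).1.
  + by move=> _ x [a _ <-]; exact: (svalP a).2.
  + move=> _ _ [a Aa <-] [b Ab <-].
    by have [/asboolP|/asboolP] := Atot a b Aa Ab; [left|right].
  have Pm : P m.
    split=> // x; apply: le_trans ((svalP a0).2 x).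
    by apply: m_le; exists a0.
  by exists (exist P m Pm) => a Aa; apply/asboolP => x; apply: m_le; exists a.
exists q => //; split=> // q' q'_sub q'q.
have Pq' : P q' by split=> // x; exact: le_trans (q'q x) (qp x).
have /qmin/(congr1 sval)// : r (exist P q (conj q_sub qp)) (exist P q' Pq').
exact/asboolP.
Qed.

Lemma minimal_sublinear_linear q : minimal_sublinear q ->
  exists u : {linear V -> R^o}, u = q :> (V -> R).
Proof.
move=> [q_sub qmin].
have qN x : q (- x) = - q x.
  have x0 : [set x] !=set0 by exists x.
  have qx d : [set x] d -> q x <= q d by move=> ->.
  have pushE : sublinear_push q [set x] (q x) = q.
    apply: qmin => [|y]; last exact: sublinear_push_le_self.
    by apply: sublinear_push_sublinear => //; exact: convex_set1.
  have := sublinear_push_opp q_sub qx (erefl x); rewrite pushE.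
  by have := sublinear_oppl x q_sub; lra.
have qD x y : q (x + y) = q x + q y.
  have := q_sub.1 x y; have := q_sub.1 (x + y) (- y); rewrite addrK qN; lra.
have qZ t x : q (t *: x) = t * q x.
  have [t0|t0] := leP 0 t; first exact: sublinearZ.
  have -> : t *: x = - ((- t) *: x) by rewrite scaleNr opprK.
  by rewrite qN sublinearZ ?oppr_ge0 ?ltW// mulNr opprK.
have qlin : linear_for *:%R (q : V -> R^o) by move=> t x y; rewrite qD qZ.
pose qM := GRing.isLinear.Build R V R^o *:%R (q : V -> R^o) qlin.
by pose u : {linear V -> R^o} := HB.pack (q : V -> R^o) qM; exists u.
Qed.

Theorem mazur_orlicz p D b : sublinear p -> D !=set0 -> @convex_set R V D ->
  (forall d, D d -> b <= p d) ->
  exists u : {linear V -> R^o},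
    (forall x, u x <= p x) /\ forall d, D d -> b <= u d.
Proof.
move=> p_sub D0 Dconv bD.
have push_sub := sublinear_push_sublinear p_sub D0 Dconv bD.
have [q /minimal_sublinear_linear[u uq] q_le] :=
  minimal_sublinear_below push_sub.
exists u; split=> [x|d Dd].
  rewrite -[u x]/((u : V -> R) x) uq.
  exact: le_trans (q_le x) (sublinear_push_le_self p_sub D0 bD x).
have := le_trans (q_le (- d)) (sublinear_push_opp p_sub bD Dd).
by rewrite -uq linearN; lra.
Qed.

End sublinear.

(** * Weak compactness in C(Y) *)

Lemma initial_cvgP (S : choiceType) (T : topologicalType) (f : S -> T)
    (F : set_system S) (s : S) : Filter F ->
  F --> (s : initial_topology f) <-> f @ F --> f s.
Proof.
move=> FF; split=> [Fs|fFs].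
  exact: cvg_comp Fs (@initial_continuous _ _ f s).
move=> A /= [_ [[B Bopen <-] Bs sBA]]; rewrite nbhs_filterE.
by apply: filterS sBA _; apply: fFs; exact: open_nbhs_nbhs.
Qed.

Lemma ptws_cvgP (U : Type) (V : topologicalType)
    (F : set_system {ptws U -> V}) (f : {ptws U -> V}) : Filter F ->
  F --> f <-> forall x, g x @[g --> F] --> f x.
Proof.
by move=> FF; split=> [/cvg_sup + x|Ff]; [move=> /(_ x)|apply/cvg_sup => x];
  rewrite ?initial_cvgP//; apply/initial_cvgP; exact: Ff.
Qed.

Definition fset_directed {T : choiceType} : set_system {fset T} :=
  filter_from setT (fun s => [set t | (s `<=` t)%fset]).

#[global] Instance fset_directed_filter (T : choiceType) :
  ProperFilter (@fset_directed T).
Proof.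
apply: filter_from_proper => [|s _]; last by exists s; exact: fsubset_refl.
apply: filter_from_filter; first by exists fset0.
by move=> s t _ _; exists (s `|` t)%fset => // u /=; rewrite fsubUset => /andP.
Qed.

Lemma near_fset_directed (T : choiceType) (x : T) :
  \forall s \near @fset_directed T, x \in s.
Proof. by exists [fset x]%fset => // s; rewrite /= fsub1set. Qed.

Lemma compact_interpolation (R : realType) (T : topologicalType) (K : set T)
    (Z : choiceType) (v : Z -> T -> R) (t : Z -> R) :
  compact K -> (forall z, continuous (v z)) ->
  (forall (s : {fset Z}) (e : R), 0 < e ->
     exists2 x, K x & forall z, z \in s -> `|v z x - t z| < e) ->
  exists2 x, K x & forall z, v z x = t z.
Proof.
move=> /compact_near_coveringP Kcov v_cts Kapprox; apply: contrapT => noint.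
pose bad (se : {fset Z} * R) x :=
  exists2 z, z \in se.1 & se.2 <= `|v z x - t z|.
have near_bad :
    \forall se \near filter_prod fset_directed (0^'+), K `<=` bad se.
  apply: Kcov => x Kx; have [z /eqP zx] : exists z, v z x <> t z.
    by apply/existsNP => vt; apply: noint; exists x.
  have d0 : 0 < `|v z x - t z| / 2 by rewrite divr_gt0 ?normr_gt0 ?subr_eq0.
  exists ([set x' | `|v z x - t z| / 2 < `|v z x' - t z|],
          [set se : {fset Z} * R | z \in se.1 /\ se.2 <= `|v z x - t z| / 2]);
    first split => /=.
  - have : `|v z x' - t z| @[x' --> x] --> `|v z x - t z|.
      by apply: cvg_norm; apply: cvgB; [exact: v_cts|exact: cvg_cst].
    move=> /cvgr_gt; apply.
    by rewrite ltr_pdivrMr// ltr_pMr ?normr_gt0 ?subr_eq0 ?ltr1n.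
  - apply: filterI; first exact: cvg_fst (near_fset_directed z).
    exact: (@cvg_snd _ _ fset_directed (0^'+) _ _ (nbhs_right_le d0)).
  - by move=> [x' [s e]] /= [/ltW dx' [zs /le_trans/(_ dx') ed]]; exists z.
have : \forall se \near filter_prod (@fset_directed Z) (0^'+), 0 < se.2 :> R.
  exact: (@cvg_snd _ _ fset_directed (0^'+) _ _ (nbhs_right_gt 0)).
move=> /(filterI near_bad)/filter_ex[[s e] /= [sbad e0]].
have [x Kx xs] := Kapprox s e e0; have [z zs] := sbad x Kx.
by rewrite leNgt xs.
Qed.

Section weak_topology.
Context (R : realType) (Y : topologicalType).
Local Notation CY := (continuousType Y R).
Local Notation WY := (weak_C R Y).
Implicit Types (f h : CY) (u : cts_dual R Y).

Lemma weak_cvgP (F : set_system WY) (h : WY) : Filter F ->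
  F --> h <-> forall u, (u f : R^o) @[f --> F] --> (u h : R^o).
Proof.
pose ev (f : CY) : {ptws cts_dual R Y -> R^o} := fun u => u f.
by move=> FF; rewrite (@initial_cvgP _ _ ev)//; exact: ptws_cvgP.
Qed.

Lemma weak_dual_continuous u : continuous (fun f : WY => u f : R^o).
Proof.
by move=> h; apply: ((weak_cvgP h (nbhs_filter h)).1 (@cvg_id _ (nbhs h))).
Qed.

Lemma weak_C_regular : regular_space WY.
Proof.
exact: (@uniform_regular
  (initial_topology ((fun f u => u f) : CY -> {ptws cts_dual R Y -> R^o}))).
Qed.

Hypothesis Y_compact : compact [set: Y].

Lemma cts_bounded f : exists K : R, forall y, `|f y| <= K.
Proof.
have /compact_bounded : compact (range (f : Y -> R^o)).
  apply: continuous_compact => //.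
  by apply: continuous_subspaceT; exact: cts_fun.
move=> /ex_strict_bound_gt0[K _ fK]; exists K => y; apply: ltW; apply: fK.
exact: imageP.
Qed.

Lemma le_supnorm f y : `|f y| <= supnorm f.
Proof.
have [K fK] := cts_bounded f.
by apply: ub_le_sup; [exists K => _ [z _ <-]|exists y].
Qed.

Lemma supnorm_le f K : 0 <= K -> (forall y, `|f y| <= K) -> supnorm f <= K.
Proof.
move=> K0 fK; rewrite /supnorm; set E := (X in sup X).
have [E0|/set0P E0] := eqVneq E set0; first by rewrite E0 sup0.
by apply: ge_sup => // _ [y _ <-].
Qed.

Lemma supnorm_ge0 f : 0 <= supnorm f.
Proof.
have [[y _]|Y0] := pselect ([set: Y] !=set0).
  exact: le_trans (normr_ge0 (f y)) (le_supnorm f y).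
by rewrite /supnorm (_ : [set: Y] = set0) ?image_set0 ?sup0//; apply/nonemptyPn.
Qed.

Lemma supnorm_sublinear : sublinear (@supnorm R Y).
Proof.
split=> [f h|t f t0].
  apply: supnorm_le => [|y]; first by rewrite addr_ge0 ?supnorm_ge0.
  exact: le_trans (ler_normD _ _) (lerD (le_supnorm f y) (le_supnorm h y)).
apply: supnorm_le => [|y]; first by rewrite mulr_ge0 ?supnorm_ge0// ltW.
by rewrite normrM gtr0_norm// ler_pM2l// le_supnorm.
Qed.

Definition point_eval (y : Y) : CY -> R^o := fun f => f y.

Let point_eval_linear y : linear_for *:%R (point_eval y).
Proof. by []. Qed.

HB.instance Definition _ y := GRing.isLinear.Build R CY R^o *:%R
  (point_eval y) (@point_eval_linear y).

Lemma cts_sumE (I : finType) (f : I -> CY) y : (\sum_i f i) y = \sum_i f i y.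
Proof. exact: (linear_sum (point_eval y)). Qed.

Lemma point_eval_bounded y :
  exists K : R, forall f, `|point_eval y f| <= K * supnorm f.
Proof. by exists 1 => f; rewrite mul1r le_supnorm. Qed.

Definition point_dual y : cts_dual R Y := CtsDual (point_eval_bounded y).

Lemma weak_eval_continuous y : continuous (fun f : WY => (f : CY) y : R^o).
Proof. exact: (@weak_dual_continuous (point_dual y)). Qed.

Lemma weak_evalB_continuous y z :
  continuous (fun f : WY => (f : CY) y - (f : CY) z : R^o).
Proof.
by move=> h; exact: (@continuousB R R^o WY (fun f : WY => (f : CY) y)
  (fun f : WY => (f : CY) z) h (@weak_eval_continuous y h)
  (@weak_eval_continuous z h)).
Qed.

Lemma dominated_dual (u : {linear CY -> R^o}) : (forall f, u f <= supnorm f) ->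
  exists v : cts_dual R Y, forall f, v f = u f.
Proof.
move=> ule; have u_bounded : exists K : R, forall f, `|u f| <= K * supnorm f.
  exists 1 => f; rewrite mul1r ler_norml ule andbT.
  have := ule (- f); rewrite linearN.
  suff : supnorm (- f) <= supnorm f by lra.
  by apply: supnorm_le => [|y]; rewrite ?supnorm_ge0//= normrN le_supnorm.
by exists (CtsDual u_bounded).
Qed.

Definition sup_lipschitz (K : R) (u : CY -> R) := forall (f h : CY) (d : R),
  0 <= d -> (forall y, `|f y - h y| <= d) -> `|u f - u h| <= K * d.

Lemma point_eval_lipschitz y : sup_lipschitz 1 (point_eval y).
Proof. by move=> f h d _ fh; rewrite mul1r; exact: fh. Qed.

Lemma dual_lipschitz u : exists2 K : R, 0 < K & sup_lipschitz K u.
Proof.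
have [K uK] := dual_bounded u; exists (`|K| + 1); first by rewrite ltr_wpDl.
move=> f h d d0 fh.
have fh_le : supnorm (f - h) <= d by exact: supnorm_le.
rewrite -linearB; apply: (le_trans (uK _)).
apply: (@le_trans _ _ (`|K| * supnorm (f - h))).
  by rewrite ler_wpM2r ?supnorm_ge0// ler_norm.
by rewrite ler_pM ?supnorm_ge0// lerDl.
Qed.

Lemma mazur_weak_closure (A : set WY) (g : CY) : closure A g ->
  forall d : R, 0 < d ->
  exists2 c : CY, conv_hull (A : set CY) c & forall y, `|c y - g y| <= d.
Proof.
move=> gA d d0; apply: contrapT => /forall2NP noc.
pose D := [set c - g | c in conv_hull (A : set CY)].
have D0 : D !=set0.
  have [a [Aa _]] := gA setT filterT.
  by exists ((a : CY) - g), a => //; exact: sub_gen_smallest.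
have Dconv : @convex_set R CY D by exact/convex_set_translate/conv_hull_convex.
have d_le (x : CY) : D x -> d <= supnorm x.
  move=> [c cc <-]; rewrite leNgt; apply/negP => cd.
  have [//|] := noc c; apply=> y; apply: ltW; apply: le_lt_trans cd.
  exact: (le_supnorm (c - g) y).
have [u [u_le uD]] := mazur_orlicz supnorm_sublinear D0 Dconv d_le.
have [v vu] := dominated_dual u_le.
have /gA[a [Aa]] : nbhs (g : WY) [set f : WY | `|v g - v f| < d].
  by have /cvgrPdist_lt/(_ _ d0) := @weak_dual_continuous v g.
rewrite /= !vu -normrN opprB -linearB; apply/negP; rewrite -leNgt.
apply: le_trans (ler_norm _); apply: uD; exists (a : CY) => //.
exact: sub_gen_smallest.
Qed.

End weak_topology.

Section james_property.
Context (R : realType).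

Definition james_property (Y : topologicalType)
    (H : set (continuousType Y R)) :=
  forall h : nat -> continuousType Y R, (forall n, H (h n)) ->
  forall e : R, 0 < e -> exists m c1 c2,
  [/\ conv_hull (h @` `I_m) c1, conv_hull (h @` [set k | (m <= k)%N]) c2 &
      forall y, `|c1 y - c2 y| <= e].

Lemma james_property_sub (Y : topologicalType)
    (H K : set (continuousType Y R)) :
  H `<=` K -> james_property K -> james_property H.
Proof. by move=> HK K_james h hH; apply: K_james => n; exact/HK/hH. Qed.

Lemma conv_hull_comp (Y Y' : topologicalType) (theta : Y' -> Y)
    (h : nat -> continuousType Y R) (h' : nat -> continuousType Y' R)
    (P : set nat) :
  (forall n y', h' n y' = h n (theta y')) ->
  forall c, conv_hull (h @` P) c ->
  exists2 c', conv_hull (h' @` P) c' & forall y', c' y' = c (theta y').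
Proof.
move=> h'h; apply: conv_hull_sub.
  by move=> _ [k Pk <-]; exists (h' k) => //; apply: sub_gen_smallest; exists k.
apply/convex_setP => x y t t01 [x' Px' x'x] [y' Py' y'y].
exists (t *: x' + (1 - t) *: y').
  by move/convex_setP: (@conv_hull_convex _ _ (h' @` P)); exact.
by move=> z; rewrite -[LHS]/(t * x' z + (1 - t) * y' z) x'x y'y.
Qed.

Lemma james_property_comp (Y Y' : topologicalType)
    (H : set (continuousType Y R)) (H' : set (continuousType Y' R)) :
  james_property H ->
  (forall h' : nat -> continuousType Y' R, (forall n, H' (h' n)) ->
     exists (h : nat -> continuousType Y R) (theta : Y' -> Y),
       (forall n, H (h n)) /\ forall n y', h' n y' = h n (theta y')) ->
  james_property H'.
Proof.
move=> H_james HH' h' h'H e e0; have [h [theta [hH h'h]]] := HH' h' h'H.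
have [m [c1 [c2 [/(conv_hull_comp h'h)[c1' c1'm c1'E]]]]] := H_james h hH e e0.
move=> /(conv_hull_comp h'h)[c2' c2'm c2'E] c12.
by exists m, c1', c2'; split=> // y'; rewrite c1'E c2'E.
Qed.

Lemma compact_james_property (Y : topologicalType) (K : set (weak_C R Y)) :
  compact [set: Y] -> compact K ->
  james_property (K : set (continuousType Y R)).
Proof.
move=> Y_compact Kc h hK e e0; pose F : set_system (weak_C R Y) := h @ \oo.
have [|g [_ Fg]] := Kc F _; first by exists 0%N => // n _; exact: hK.
have tail_closure m :
    closure ((h @` [set k | (m <= k)%N]) : set (weak_C R Y)) g.
  by move=> B gB; apply: Fg => //; exists m => // k mk; exists k.
have e2 : 0 < e / 2 by rewrite divr_gt0.
have [c1 c1h c1g] := mazur_weak_closure Y_compact (tail_closure 0%N) e2.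
have [m c1m] : exists m, conv_hull (h @` `I_m) c1.
  by apply: conv_hull_range; apply: conv_hull_mono c1h => _ [k _ <-]; exists k.
have [c2 c2m c2g] := mazur_weak_closure Y_compact (tail_closure m) e2.
exists m, c1, c2; split=> // y.
by have := c1g y; have := c2g y; rewrite !ler_norml; lra.
Qed.

End james_property.

Lemma ultra_bounded_cvg (R : realType) (T : Type) (U : set_system T) (H : set T)
    (f : T -> R) (K : R) : UltraFilter U -> U H ->
  (forall h, H h -> `|f h| <= K) ->
  exists l : R, (f h : R^o) @[h --> U] --> (l : R^o).
Proof.
move=> UU UH fK; have UP : ProperFilter U by exact: ultra_proper.
have [|l [_ fl]] := @segment_compact R (- K) K ((f : T -> R^o) @ U) _.
  apply: (@filterS _ U _ H) => // h Hh /=.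
  by rewrite in_itv /= -ler_norml; exact: fK.
exists l; apply/cvgrPdist_lt => e e0.
have [//|far] := in_ultra_setVsetC [set h | `|l - f h| < e] UU.
have [x [/= xl lx]] : [set x | e <= `|l - x|] `&` ball (l : R^o) e !=set0.
  apply: fl (nbhsx_ballx _ _ e0).
  by apply: (@filterS _ U _ _ _ _ far) => h /= /negP; rewrite -leNgt.
by have := le_lt_trans xl lx; rewrite ltxx.
Qed.

Lemma ultra_precompact (T : topologicalType) (H : set T) : regular_space T ->
  (forall U : set_system T, UltraFilter U -> U H -> exists e : T, U --> e) ->
  precompact H.
Proof.
move=> T_regular H_lim; rewrite precompactE compact_ultra => W WU WH.
pose F := filter_from [set O | open O /\ W O] (fun O => H `&` O).
have WP : ProperFilter W by exact: ultra_proper.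
have FF : ProperFilter F.
  apply: filter_from_proper => [|O [Oopen WO]]; last first.
    have [x [xH xO]] := filter_ex (filterI WH WO).
    by apply: xH; exact: open_nbhs_nbhs.
  apply: filter_from_filter => [|O P [Oo WO] [Po WP']].
    by exists setT; split; [exact: openT|exact: filterT].
  exists (O `&` P) => [|x [Hx [Ox Px]]]; last by split; split.
  by split; [exact: openI|exact: filterI].
have Fopen O : open O -> W O -> F (H `&` O) by exists O.
have [U [UU FU]] := ultraFilterLemma FF.
have UP : ProperFilter U by exact: ultra_proper.
have UH : U H.
  by apply: FU; rewrite -(setIT H); apply: Fopen; [exact: openT|exact: filterT].
have [e Ue] := H_lim U UU UH.
have We : W --> e.
  move=> A /T_regular[N Ne NA].
  have [WN|WN] := in_ultra_setVsetC (closure N) WU; first exact: filterS WN.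
  have /FU UC := Fopen _ (closed_openC (@closed_closure _ N)) WN.
  have [x [Nx [_]]] := filter_ex (filterI (Ue _ Ne) UC).
  by case; exact: subset_closure.
exists e; split=> // A eA.
have [x [xH xA]] := filter_ex (filterI WH (We _ (nbhs_interior eA))).
exact: xH xA.
Qed.

Lemma filter_sequence (T : Type) (F : set_system T) (A : seq T -> set T) :
  ProperFilter F -> (forall s, F (A s)) ->
  exists h : nat -> T, forall m k, (m <= k)%N -> A (mkseq h m) (h k).
Proof.
move=> FP FA; pose B s := \bigcap_(m < (size s).+1) A (take m s).
have FB s : F (B s).
  rewrite /B bigcap_mkord; elim/big_ind: _ => //; first exact: filterT.
  exact: filterI.
have /choice[next nextP] : forall s, exists x, B s x.
  by move=> s; exact: filter_ex (FB s).
pose prefix n := iter n (fun s => rcons s (next s)) [::].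
have prefixE n : prefix n = mkseq (next \o prefix) n.
  by elim: n => // n IH; rewrite mkseqS -IH.
exists (next \o prefix) => m k mk; have := nextP (prefix k) m.
by rewrite {1 2}prefixE size_mkseq -map_take take_iota (minn_idPl mk); apply.
Qed.

Section james_precompact.
Context (R : realType) (Y : topologicalType).
Local Notation CY := (continuousType Y R).
Local Notation WY := (weak_C R Y).
Hypothesis Y_compact : compact [set: Y].

Definition totally_bounded (B : set CY) := forall d : R, 0 < d ->
  exists s : seq CY, forall v, B v ->
    exists2 w, w \in s & forall y, `|v y - w y| <= d.

Definition zonotope n (x : 'I_n -> CY) : set CY :=
  [set \sum_i t i *: x i | t in [set t : 'I_n -> R | forall i, 0 <= t i <= 1]].

Lemma convex_zonotope n (x : 'I_n -> CY) : @convex_set R CY (zonotope x).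
Proof.
apply/convex_setP => _ _ t /andP[t0 t1] [a a01 <-] [b b01 <-].
exists (fun i => t * a i + (1 - t) * b i) => [i|].
  have /andP[? ?] := a01 i; have /andP[? ?] := b01 i.
  by apply/andP; split; nra.
rewrite !scaler_sumr -big_split; apply: eq_bigr => i _.
by rewrite [LHS]scalerDl !scalerA.
Qed.

Lemma sub_zonotope n (x : 'I_n -> CY) : range x `<=` zonotope x.
Proof.
move=> _ [i _ <-]; exists (fun k => (k == i)%:R) => [k|].
  by case: (k == i); rewrite /= ?lexx ler01.
rewrite (bigD1 i)//= eqxx scale1r big1 ?addr0// => k /negbTE ->.
by rewrite scale0r.
Qed.

Lemma grid_approx (N : nat) (t : R) : (0 < N)%N -> 0 <= t <= 1 ->
  exists k : 'I_N.+1, `|t - k%:R / N%:R| <= N%:R^-1.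
Proof.
move=> N0 /andP[t0 t1]; have N_gt0 : 0 < N%:R :> R by rewrite ltr0n.
have /andP[k_le k_gt] := truncn_itv (mulr_ge0 t0 (ltW N_gt0)).
have kN : (Num.truncn (t * N%:R) < N.+1)%N.
  by rewrite ltnS -(ler_nat R) (le_trans k_le)// ler_piMl// ltW.
exists (Ordinal kN); rewrite /= -[t in t - _](mulfK (lt0r_neq0 N_gt0)) -mulrBl.
rewrite normrM normfV (gtr0_norm N_gt0) ler_piMl ?invr_ge0 ?ltW//.
by rewrite ger0_norm ?subr_ge0// ltrBlDr addrC natr1.
Qed.

Lemma totally_bounded_zonotope n (x : 'I_n -> CY) :
  totally_bounded (zonotope x).
Proof.
move=> d d0; have /choice[B xB] : forall i, exists K, forall y, `|x i y| <= K.
  by move=> i; exact: cts_bounded.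
pose K := \sum_i `|B i|.
pose N := (Num.truncn (K / d)).+1.
have KN : K / N%:R <= d.
  have K0 : 0 <= K by rewrite sumr_ge0.
  have /andP[_] := truncn_itv (divr_ge0 K0 (ltW d0)).
  by rewrite ltr_pdivrMr// ler_pdivrMr ?ltr0n// mulrC => /ltW.
pose grid (k : {ffun 'I_n -> 'I_N.+1}) : CY := \sum_i ((k i)%:R / N%:R) *: x i.
exists (codom grid).
move=> _ [t t01 <-].
have /choice[k kP] : forall i, exists k : 'I_N.+1,
    `|t i - k%:R / N%:R| <= N%:R^-1.
  by move=> i; exact: grid_approx.
exists (grid (finfun k)); first exact: codom_f.
move=> y; rewrite /grid !cts_sumE -sumrB; apply: le_trans KN.
apply: (le_trans (ler_norm_sum _ _ _)).
rewrite mulr_suml; apply: ler_sum => i _.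
rewrite ffunE -mulrBl normrM mulrC.
apply: ler_pM => //.
by rewrite (le_trans (xB i y))// ler_norm.
Qed.

Lemma totally_bounded_conv_hull (s : seq CY) :
  totally_bounded (conv_hull [set` s]).
Proof.
move=> d d0; have [net netP] := totally_bounded_zonotope (tnth (in_tuple s)) d0.
exists net => v sv; apply: netP.
apply: conv_hull_sub sv; last exact: convex_zonotope.
by move=> x /= /(tnthP (in_tuple s))[i ->]; apply: sub_zonotope; exists i.
Qed.

Definition near_convex_hulls (U : set_system WY) (d : R) (e : CY) :=
  forall A : set WY, U A ->
  exists2 c : CY, conv_hull (A : set CY) c & forall y, `|c y - e y| <= d.

Lemma near_convex_hulls_lipschitz (U : set_system WY) {UF : Filter U}
    (u : {linear CY -> R^o}) (l K d : R) (e : CY) :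
  sup_lipschitz K u -> (u f : R^o) @[f --> U] --> (l : R^o) -> 0 <= d ->
  near_convex_hulls U d e -> `|u e - l| <= K * d.
Proof.
move=> uK ul d0 e_near; apply/ler_addgt0Pr => b b0.
have [c cA ce] : exists2 c : CY, `|u c - l| <= b & forall y, `|e y - c y| <= d.
  have Ub : U [set f : WY | `|u f - l| <= b].
    by have /cvgrPdist_le/(_ _ b0) := ul; apply: filterS => f; rewrite distrC.
  have [c cb ce] := e_near _ Ub; exists c => [|y]; last by rewrite distrC.
  suff : [set f : CY | `|u f - l| <= b] c by [].
  by apply: conv_hull_sub cb => //; exact: convex_set_strip.
by rewrite -(subrKA (u c)) (le_trans (ler_normD _ _))// lerD// uK.
Qed.

Section ultrafilter.
Context (H : set WY) (U : set_system WY).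
Hypotheses (H_james : james_property (H : set CY)) (UU : UltraFilter U)
  (UH : U H).

Lemma far_from_totally_bounded (d : R) (B : set CY) : 0 < d ->
  totally_bounded B -> ~ (exists e, near_convex_hulls U d e) ->
  exists2 A, U A & forall v c, B v -> conv_hull (A : set CY) c ->
    ~ forall y, `|v y - c y| <= d / 2.
Proof.
move=> d0 Btb no_near.
have [s sP] := Btb (d / 2) (divr_gt0 d0 (ltr0Sn _ 1)).
have [A UA Afar] : exists2 A, U A & forall w, w \in s ->
    forall c, conv_hull (A : set CY) c -> ~ forall y, `|c y - w y| <= d.
  elim: {sP} s => [|w s [A UA Afar]].
    by exists setT => //; exact: filterT.
  have [A' UA' A'far] : exists2 A, U A & forall c, conv_hull (A : set CY) c ->
      ~ forall y, `|c y - w y| <= d.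
    apply: contrapT => noA; apply: no_near; exists w => A' UA'.
    apply: contrapT => noc; apply: noA; exists A' => // c A'c cw.
    by apply: noc; exists c.
  exists (A `&` A') => [|z]; first exact: filterI.
  rewrite in_cons => /orP[/eqP->|zs] c AA'c.
    by apply: A'far; apply: conv_hull_mono AA'c => x [].
  by apply: Afar zs _ _; apply: conv_hull_mono AA'c => x [].
exists A => // v c Bv Ac vc; have [w ws vw] := sP v Bv.
apply: (Afar w ws c Ac) => y; have := vc y; have := vw y.
by rewrite !ler_norml; lra.
Qed.

(* Otherwise one picks [h_n] in smaller and smaller members of [U], keeping the
   hull of the later ones away from the hull of the earlier ones. *)
Lemma ultra_near_convex_hulls (d : R) : 0 < d ->
  exists e, near_convex_hulls U d e.
Proof.
move=> d0; apply: contrapT => no_near.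
have /choice[A /all_and2[UA Afar]] : forall s : seq CY, exists A : set WY,
    U A /\ forall v c, conv_hull [set` s] v -> conv_hull (A : set CY) c ->
      ~ forall y, `|v y - c y| <= d / 2.
  move=> s; have [A UA Afar] :=
    far_from_totally_bounded d0 (@totally_bounded_conv_hull s) no_near.
  by exists A.
have [|h hP] := @filter_sequence CY U (fun s => H `&` A s) _.
  by move=> s; exact: filterI.
have d2 : 0 < d / 2 by rewrite divr_gt0.
have [n|m [c1 [c2 [c1m c2m c12]]]] := H_james (h := h) _ d2.
  by have [] := hP 0%N n (leq0n n).
apply: (Afar (mkseq h m) c1 c2) => //.
  apply: conv_hull_mono c1m => _ [k /= km <-]; apply/mapP; exists k => //.
  by rewrite mem_iota.
by apply: conv_hull_mono c2m => _ [k /= mk <-]; have [] := hP m k mk.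
Qed.

Hypothesis H_bounded : exists K : R, forall h y, H h -> `|(h : CY) y| <= K.

Lemma ultra_uniform_hull_limit : exists g : CY, forall d : R, 0 < d ->
  exists2 e, near_convex_hulls U d e & forall y, `|e y - g y| <= d.
Proof.
have [K HK] := H_bounded.
have /choice[E EU] : forall y, exists l : R^o, (f : CY) y @[f --> U] --> l.
  by move=> y; apply: (ultra_bounded_cvg (K := K) UU UH) => h Hh; exact: HK.
have E_approx (d : R) : 0 < d ->
    exists2 e, near_convex_hulls U d e & forall y, `|e y - E y| <= d.
  move=> d0; have [e e_near] := ultra_near_convex_hulls d0; exists e => // y.
  rewrite -[d]mul1r.
  have y_lip := @point_eval_lipschitz R Y y.
  exact: near_convex_hulls_lipschitz y_lip (EU y) (ltW d0) e_near.
have E_cts : continuous (E : Y -> R).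
  move=> y; apply/cvgrPdist_lt => d d0.
  have d3 : 0 < d / 3 by rewrite divr_gt0.
  have [e _ eE] := E_approx _ d3.
  have /cvgrPdist_lt/(_ _ d3) := @cts_fun _ _ e y.
  apply: filterS => z /=; have := eE y; have := eE z.
  by rewrite !ler_norml !ltr_norml; lra.
by exists (mkcts E_cts : CY).
Qed.

Lemma ultra_weak_cvg : exists g : WY, U --> g.
Proof.
have [g g_approx] := ultra_uniform_hull_limit.
have [K HK] := H_bounded; exists (g : WY); apply/weak_cvgP => u.
have [L L0 uL] := dual_lipschitz Y_compact u.
have [l ul] : exists l : R^o, (u f : R^o) @[f --> U] --> l.
  apply: (ultra_bounded_cvg (K := L * `|K|) UU UH) => h Hh.
  rewrite -[u _]subr0 -(linear0 u) uL// => y.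
  by rewrite subr0 (le_trans (HK _ _ Hh))// ler_norm.
suff -> : u g = l by [].
apply/eqP; rewrite -subr_eq0 -normr_le0; apply/ler_addgt0Pr => b b0.
have d0 : 0 < b / (2 * L) by rewrite divr_gt0 ?mulr_gt0.
have [e e_near eg] := g_approx _ d0.
rewrite -(subrKA (u e)) (le_trans (ler_normD _ _))// add0r.
rewrite (_ : b = L * (b / (2 * L)) + L * (b / (2 * L))); last first.
  by field; rewrite gt_eqF.
rewrite lerD//; last exact: near_convex_hulls_lipschitz uL ul (ltW d0) e_near.
by apply: uL (ltW d0) _ => y; rewrite distrC.
Qed.

End ultrafilter.

Theorem james_precompact (H : set WY) :
  (exists K : R, forall h y, H h -> `|(h : CY) y| <= K) ->
  james_property (H : set CY) -> precompact H.
Proof.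
move=> H_bounded H_james; apply: ultra_precompact; first exact: weak_C_regular.
by move=> U UU UH; exact: ultra_weak_cvg H_james UU UH H_bounded.
Qed.

End james_precompact.

Section wap.
Context (R : realType) (G : groupType) (Y : topologicalType) (phi : flow G Y).
Local Notation CY := (continuousType Y R).
Hypothesis Y_compact : compact [set: Y].
Implicit Types f : CY.

Definition orbit_closure f : set CY :=
  closure (range (fun g => translate phi g f : weak_C R Y)).

Lemma sub_orbit_closure f g : orbit_closure f (translate phi g f).
Proof. by apply: subset_closure; exists g. Qed.

Lemma wap_orbit_closure_james f :
  wap_fun phi f -> james_property (orbit_closure f).
Proof. by rewrite /wap_fun precompactE; exact: compact_james_property. Qed.

Lemma wap_funP f :
  wap_fun phi f <-> james_property (range (fun g => translate phi g f)).
Proof.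
split=> [/wap_orbit_closure_james|f_james].
  by apply: james_property_sub => _ [g _ <-]; exact: sub_orbit_closure.
apply: james_precompact f_james => //.
by have [K fK] := cts_bounded Y_compact f; exists K => _ y [g _ <-]; exact: fK.
Qed.

Lemma wap_orbit_closure_interpolation f (Z : choiceType)
    (v : Z -> weak_C R Y -> R) (t : Z -> R) : wap_fun phi f ->
  (forall z, continuous (v z)) ->
  (forall (s : {fset Z}) (e : R), 0 < e ->
     exists g, forall z, z \in s -> `|v z (translate phi g f) - t z| < e) ->
  exists2 h, orbit_closure f h & forall z, v z h = t z.
Proof.
rewrite /wap_fun precompactE => f_wap v_cts vt.
apply: (compact_interpolation f_wap v_cts) => s e e0.
have [g gP] := vt s e e0; exists (translate phi g f) => //.
exact: sub_orbit_closure.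
Qed.

Lemma wap_orbit_closure_pointwise f (Z : choiceType) (y : Z -> Y) (t : Z -> R) :
  wap_fun phi f ->
  (forall (s : {fset Z}) (e : R), 0 < e ->
     exists g, forall z, z \in s -> `|f (phi g^-1%g (y z)) - t z| < e) ->
  exists2 h, orbit_closure f h & forall z, h (y z) = t z.
Proof.
move=> f_wap; apply: (wap_orbit_closure_interpolation
  (v := fun z (h : weak_C R Y) => (h : CY) (y z)) f_wap) => z.
exact: weak_eval_continuous.
Qed.

End wap.

(** * Quotients of compact Hausdorff spaces *)

Lemma eq_on_closure (X T : topologicalType) (f g : X -> T) (A : set X) :
  hausdorff_space T -> continuous f -> continuous g ->
  (forall x, A x -> f x = g x) -> forall x, closure A x -> f x = g x.
Proof.
move=> T_haus f_cts g_cts fg x xA; apply: T_haus => B C fB gC.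
have [|z [Az [fz gz]]] := xA (f @^-1` B `&` g @^-1` C).
  by apply: filterI; [exact: f_cts|exact: g_cts].
by exists (f z); split=> //; rewrite fg.
Qed.

Lemma closed_kernel (X T : topologicalType) (f : X -> T) : hausdorff_space T ->
  continuous f -> closed [set xy : X * X | f xy.1 = f xy.2].
Proof.
move=> T_haus f_cts.
apply: (eq_on_closure (f := f \o fst) (g := f \o snd)) => //.
- by move=> xy; apply: continuous_comp; [exact: cvg_fst|exact: f_cts].
- by move=> xy; apply: continuous_comp; [exact: cvg_snd|exact: f_cts].
Qed.

Lemma compact_image_closed (X T : topologicalType) (K : set X) (f : X -> T) :
  compact K -> hausdorff_space T -> continuous f ->
  forall A, closed A -> closed (f @` (K `&` A)).
Proof.
move=> Kc T_haus f_cts A Acl; apply: compact_closed => //.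
apply: continuous_compact; first exact: continuous_subspaceT.
exact: compact_closedI.
Qed.

Lemma compact_factor_continuous (X Y T : topologicalType) (K : set X)
    (r : X -> Y) (f : Y -> T) (g : X -> T) :
  compact K -> hausdorff_space Y -> continuous r ->
  (forall y, exists2 x, K x & r x = y) ->
  continuous g -> (forall x, K x -> f (r x) = g x) -> continuous f.
Proof.
move=> Kc Y_haus r_cts r_surj g_cts frg; apply/continuous_closedP => B Bcl.
have -> : f @^-1` B = r @` (K `&` g @^-1` B).
  apply/seteqP; split=> [y By|_ [x [Kx Bgx] <-]]; last by rewrite /= frg.
  have [x Kx rx] := r_surj y; exists x => //; split=> //.
  by rewrite /= -frg// rx.
apply: compact_image_closed => //.
by apply: preimage_closed => // x _; exact: g_cts.
Qed.

Lemma closed_map_normal (R : realType) (X T : topologicalType) (f : X -> T) :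
  normal_space X -> continuous f -> (forall A, closed A -> closed (f @` A)) ->
  (forall t, exists x, f x = t) -> normal_space T.
Proof.
move=> /(@normal_openP R) X_normal f_cts f_closed f_surj.
apply/(@normal_openP R) => A B Acl Bcl AB0.
have pre_closed C : closed C -> closed (f @^-1` C).
  by move=> Ccl; apply: preimage_closed => // x _; exact: f_cts.
have [|U [V [Uo Vo AU BV UV0]]] :=
    X_normal _ _ (pre_closed A Acl) (pre_closed B Bcl).
  by rewrite -preimage_setI AB0 preimage_set0.
exists (~` (f @` ~` U)), (~` (f @` ~` V)); split.
- exact/closed_openC/f_closed/open_closedC.
- exact/closed_openC/f_closed/open_closedC.
- by move=> t At [x Ux xt]; apply: Ux; apply: AU; rewrite /= xt.
- by move=> t Bt [x Vx xt]; apply: Vx; apply: BV; rewrite /= xt.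
rewrite -subset0 => t [tU tV]; have [x xt] := f_surj t.
have : (U `&` V) x.
  by split; apply: contrapT => nx; [apply: tU|apply: tV]; exists x.
by rewrite UV0.
Qed.

Lemma normal_hausdorff (R : realType) (T : topologicalType) : normal_space T ->
  (forall x : T, closed [set x]) -> hausdorff_space T.
Proof.
move=> /(@normal_openP R) T_normal T1; rewrite open_hausdorff => x y xy.
have [|U [V [Uo Vo xU yV UV0]]] := T_normal _ _ (T1 x) (T1 y).
  by rewrite -subset0 => z [-> yx]; rewrite yx eqxx in xy.
exists (U, V); first by split; rewrite inE; [exact: xU|exact: yV].
by split=> //; apply/eqP.
Qed.

Section compact_hausdorff.
Context (R : realType) (X : topologicalType).
Hypotheses (X_compact : compact [set: X]) (X_haus : hausdorff_space X).

Lemma cts_separate_points x y :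
  (forall k : continuousType X R, k x = k y) -> x = y.
Proof.
move=> kxy; apply: contrapT => xy.
have X_normal := compact_normal X_haus X_compact.
have X_T1 := hausdorff_accessible X_haus.
have [|k [k_cts _ k0 k1]] := (@uniform_separatorP _ R _ _).1
    (@normal_completely_regular R _ X_normal X_T1 x [set y] _ xy).
  exact: accessible_closed_set1.
have : k x = k y := kxy (mkcts k_cts).
have -> : k x = 0 by apply: k0; exists x.
have -> : k y = 1 by apply: k1; exists y.
by move=> /esym/eqP; rewrite oner_eq0.
Qed.

(* Tietze's theorem on the closed image of [s]. *)
Lemma cts_factor_extension (Y : topologicalType) (s : Y -> X)
    (f : continuousType Y R) : compact [set: Y] -> continuous s ->
  (forall y z, s y = s z -> f y = f z) ->
  exists k : continuousType X R, forall y, k (s y) = f y.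
Proof.
move=> Y_compact s_cts sf; have [M fM] := cts_bounded Y_compact f.
have s_closed A : closed A -> closed (s @` A).
  by move=> Acl; rewrite -(setTI A); exact: compact_image_closed.
have [y0|Y0] := pselect (exists y : Y, True); last first.
  by exists (cst 0) => y; case: Y0; exists y.
have /choice[sel selP] : forall x, exists y, range s x -> s y = x.
  move=> x; have [[y _ yx]|nx] := pselect (range s x); first by exists y.
  by have [y _] := y0; exists y.
have sel_s y : f (sel (s y)) = f y by apply: sf; apply: selP; exists y.
have f_sel_cts : {within range s, continuous (f \o sel : X -> R^o)}.
  apply/continuous_closedP => B Bcl; apply/closed_subspaceP.
  exists (s @` (f @^-1` B)).
    by apply: s_closed; apply: preimage_closed => // y _; exact: cts_fun.
  apply/seteqP; split=> [_ [[y By <-] sy]|x [selB [y _ yx]]].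
    by split=> //; change (B (f (sel (s y)))); rewrite sel_s.
  split; exists y => //; change (B (f (sel x))) in selB.
  by move: selB; rewrite -yx sel_s.
have [||k [kf k_cts _]] := continuous_bounded_extension
    (compact_normal X_haus X_compact) (s_closed setT closedT) (M := `|M| + 1)
    _ f_sel_cts _.
- by rewrite ltr_wpDl.
- move=> x _; apply: le_trans (fM (sel x)) _.
  by rewrite (le_trans (ler_norm M))// lerDl.
exists (mkcts k_cts) => y.
change (k (s y) = f y); rewrite -kf; first exact: sel_s.
by rewrite inE; exists y.
Qed.

End compact_hausdorff.

Section closed_quotient.
Local Open Scope quotient_scope.
Context (R : realType) (Y : topologicalType) (F : equiv_rel Y).
Local Notation Q := (quotient_topology {eq_quot F}).

Definition quot_pi : Y -> Q := \pi_Q.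

Lemma quot_piP x y : quot_pi x = quot_pi y <-> F x y.
Proof. by split=> [/eqmodP|/eqmodP]. Qed.

Lemma quot_pi_repr q : quot_pi (repr q) = q.
Proof. exact: reprK. Qed.

Lemma quot_pi_continuous : continuous quot_pi.
Proof. exact: pi_continuous. Qed.

Hypothesis Y_compact : compact [set: Y].

Lemma quotient_compact : compact [set: Q].
Proof.
have <- : range quot_pi = [set: Q].
  by apply/seteqP; split=> // q _; exists (repr q) => //; exact: quot_pi_repr.
apply: continuous_compact => //.
exact/continuous_subspaceT/quot_pi_continuous.
Qed.

Hypotheses (Y_haus : hausdorff_space Y)
  (F_closed : closed [set xy : Y * Y | F xy.1 xy.2]).

Lemma quot_pi_closed (A : set Y) : closed A -> closed (quot_pi @` A).
Proof.
move=> A_closed.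
suff /closed_openC : closed (quot_pi @^-1` (quot_pi @` A)).
  by rewrite preimage_setC => Ao; rewrite -openC.
have -> : quot_pi @^-1` (quot_pi @` A) =
    snd @` ([set: Y * Y] `&` ([set xy | F xy.1 xy.2] `&` fst @^-1` A)).
  apply/seteqP; split=> [y [x Ax /quot_piP xy]|_ [[x y] [_ [/= xy Ax]] <-]].
    by exists (x, y).
  by exists x => //; exact/quot_piP.
apply: compact_image_closed => //.
- by rewrite -setXTT; exact: compact_setX.
- by move=> xy; exact: cvg_snd.
- by apply: closedI => //; apply: preimage_closed => // xy _; exact: cvg_fst.
Qed.

Lemma quotient_hausdorff : hausdorff_space Q.
Proof.
have pi_surj q : exists y, quot_pi y = q.
  by exists (repr q); exact: quot_pi_repr.
apply: (normal_hausdorff R) => [|q].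
  apply: (closed_map_normal R (compact_normal Y_haus Y_compact)) pi_surj.
    exact: quot_pi_continuous.
  exact: quot_pi_closed.
rewrite -(quot_pi_repr q) -image_set1; apply: quot_pi_closed.
exact/accessible_closed_set1/hausdorff_accessible.
Qed.

End closed_quotient.

Section ker_equiv.
Context (Y : Type) (T : eqType) (f : Y -> T).

Definition ker_rel : rel Y := fun x y => f x == f y.

Lemma ker_rel_refl : reflexive ker_rel.
Proof. by move=> x; exact: eqxx. Qed.

Lemma ker_rel_sym : symmetric ker_rel.
Proof. by move=> x y; exact: eq_sym. Qed.

Lemma ker_rel_trans : transitive ker_rel.
Proof. by move=> y x z /eqP xy /eqP yz; rewrite /ker_rel xy yz. Qed.

Definition ker_equiv : equiv_rel Y :=
  EquivRel ker_rel ker_rel_refl ker_rel_sym ker_rel_trans.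

Lemma ker_equivP x y : ker_equiv x y <-> f x = f y.
Proof. by split=> /eqP. Qed.

End ker_equiv.

(** * Transfer of WAP relations along a factor map *)

Section quotient_flow_translates.
Local Open Scope quotient_scope.
Context (R : realType) (G : groupType) (Y : topologicalType) (phi : flow G Y).
Context (F : equiv_rel Y) (F_inv : invariant_rel phi F).

Lemma quotient_flow_pi g y :
  quotient_flow F_inv g (quot_pi F y) = quot_pi F (phi g y).
Proof. exact: quotient_act_pi. Qed.

Lemma translate_quot_pi g (k : continuousType _ R) y :
  translate (quotient_flow F_inv) g k (quot_pi F y) =
  k (quot_pi F (phi g^-1%g y)).
Proof. by congr (k _); exact: quotient_flow_pi. Qed.

Lemma cts_quot_pi (k : continuousType (quotient_topology {eq_quot F}) R) :
  continuous (k \o quot_pi F).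
Proof.
by move=> y; apply: continuous_comp; [exact: quot_pi_continuous|exact: cts_fun].
Qed.

Lemma flow_actK g y : phi g (phi g^-1%g y) = y.
Proof. by rewrite -flow_actM mulgV flow_act1. Qed.

End quotient_flow_translates.

Section factor_map.
Local Open Scope quotient_scope.
Context (R : realType) (G G' : groupType) (Y Y' : topologicalType).
Context (phi : flow G Y) (phi' : flow G' Y') (r : Y' -> Y).
(* Below, [Z] is [X(C)], and [y] and [y'] send a tuple to its types over [C] and
   over [C']. *)
Context (Z : choiceType) (y : Z -> Y) (y' : Z -> Y').
Hypotheses (Y_compact : compact [set: Y]) (Y_haus : hausdorff_space Y)
  (Y'_compact : compact [set: Y']) (r_continuous : continuous r)
  (r_lift : forall z, r (y' z) = y z) (y_dense : forall p, closure (range y) p).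

Definition lift_closure := closure (range y').

Lemma lift_closure_compact : compact lift_closure.
Proof. exact: subclosed_compact (@closed_closure _ _) Y'_compact _. Qed.

Lemma sub_lift_closure z : lift_closure (y' z).
Proof. by apply: subset_closure; exists z. Qed.

Lemma lift_closure_surj p : exists2 p', lift_closure p' & r p' = p.
Proof.
have r_closed : closed (r @` (setT `&` lift_closure)).
  exact: compact_image_closed (@closed_closure _ _).
have y_lift : range y `<=` r @` (setT `&` lift_closure).
  move=> _ [z _ <-].
  by exists (y' z); [split=> //; exact: sub_lift_closure|exact: r_lift].
have /r_closed[p' [_ Dp'] <-] := closureS y_lift (@y_dense p).
by exists p'.
Qed.

Section lift.
Context (zact : G -> Z -> Z).
Hypotheses (Y'_haus : hausdorff_space Y')
  (y_act : forall g z, phi g (y z) = y (zact g z)).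

Definition fibre_flattening := forall (f : Y' -> R) (s : {fset Z}) (e : R),
  continuous f -> 0 < e -> exists g' : G',
    (forall z, z \in s -> `|f (phi' g'^-1%g (y' z)) - f (y' z)| < e) /\
    forall p' q', r p' = r q' ->
      `|f (phi' g'^-1%g p') - f (phi' g'^-1%g q')| < e.

Definition action_imitation :=
  forall (f : Y' -> R) (g : G) (s : {fset Z}) (e : R), continuous f -> 0 < e ->
  exists g' : G', forall z, z \in s ->
    `|f (phi' g'^-1%g (y' z)) - f (y' (zact g^-1%g z))| < e.

Hypotheses (r_flattening : fibre_flattening) (r_imitation : action_imitation).
Context (F' : equiv_rel Y') (F'_wap : wap_quotient_rel R phi' F').
Local Notation Q' := (quotient_topology {eq_quot F'}).
Local Notation CQ' := (continuousType Q' R).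
Local Notation pi' := (quot_pi F').

Let Q'_compact : compact [set: Q'] := quotient_compact Y'_compact.
Let Q'_haus : hausdorff_space Q' :=
  quotient_hausdorff R Y'_compact Y'_haus F'_wap.1.

Lemma wap_limit_constant_on_fibres (k : CQ') : exists h : CQ',
  (forall z, h (pi' (y' z)) = k (pi' (y' z))) /\
  forall p' q', r p' = r q' -> h (pi' p') = h (pi' q').
Proof.
have [_ [F'_inv F'_flow]] := F'_wap.
pose fibre_pair := {pq : Y' * Y' | r pq.1 == r pq.2}.
pose v (x : Z + fibre_pair) (h : weak_C R Q') : R :=
  match x with
  | inl z => (h : CQ') (pi' (y' z))
  | inr pq => (h : CQ') (pi' (sval pq).1) - (h : CQ') (pi' (sval pq).2)
  end.
pose t (x : Z + fibre_pair) : R := if x is inl z then k (pi' (y' z)) else 0.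
have [[z|pq]|s e e0|h _ ht] :=
    wap_orbit_closure_interpolation (v := v) (t := t) (F'_flow k).
- exact: weak_eval_continuous.
- exact: weak_evalB_continuous.
- pose inl_part (x : Z + fibre_pair) := if x is inl z then Some z else None.
  pose sZ := [fset z in pmap inl_part s]%fset.
  have [g' [g'z g'r]] := r_flattening sZ (@cts_quot_pi _ _ _ k) e0.
  exists g' => -[z zs|[[p q] /= /eqP pq] _]; rewrite /v /= !translate_quot_pi.
    apply: g'z; rewrite inE mem_pmap; apply/mapP; exists (inl z) => //.
  by rewrite subr0; exact: g'r.
exists h; split=> [z|p' q' /eqP pq]; first exact: (ht (inl z)).
apply/eqP; rewrite -subr_eq0; apply/eqP.
exact: (ht (inr (exist _ (p', q') pq))).
Qed.

Lemma fibre_collapse p' q' : lift_closure p' -> lift_closure q' ->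
  r p' = r q' -> pi' p' = pi' q'.
Proof.
move=> Dp Dq pq; apply: (cts_separate_points (R := R) Q'_compact Q'_haus) => k.
have [h [hk hr]] := wap_limit_constant_on_fibres k.
have hkD x : lift_closure x -> h (pi' x) = k (pi' x).
  apply: (@eq_on_closure _ _ (h \o pi') (k \o pi')).
  - exact: Rhausdorff.
  - exact: cts_quot_pi.
  - exact: cts_quot_pi.
  - by move=> _ [z _ <-]; exact: hk.
by rewrite -!hkD//; exact: hr.
Qed.

Definition lift_pi (p : Y) : Q' := pi' (s2val (cid2 (lift_closure_surj p))).

Lemma lift_piP p : exists2 p', lift_closure p' & r p' = p /\ lift_pi p = pi' p'.
Proof.
by rewrite /lift_pi; case: cid2 => p' Dp' rp'; exists p'.
Qed.

Lemma lift_pi_restr p' : lift_closure p' -> lift_pi (r p') = pi' p'.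
Proof.
move=> Dp'; have [q' Dq' [rq' ->]] := lift_piP (r p').
exact: fibre_collapse.
Qed.

Lemma lift_pi_continuous : continuous lift_pi.
Proof.
apply: (compact_factor_continuous lift_closure_compact Y_haus r_continuous
  lift_closure_surj (@quot_pi_continuous _ F') lift_pi_restr).
Qed.

Lemma cts_lift_pi (k : CQ') : continuous (k \o lift_pi).
Proof.
by move=> p; apply: continuous_comp; [exact: lift_pi_continuous|exact: cts_fun].
Qed.

Lemma lift_pi_translate (F'_inv : invariant_rel phi' F')
    (F'_flow : wap_flow R (quotient_flow F'_inv)) (k : CQ') g :
  exists2 h, orbit_closure (quotient_flow F'_inv) k h &
    forall p, h (lift_pi p) = k (lift_pi (phi g^-1%g p)).
Proof.
have lift_pi_y z : lift_pi (y z) = pi' (y' z).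
  by rewrite -r_lift lift_pi_restr//; exact: sub_lift_closure.
pose t z : R := k (pi' (y' (zact g^-1%g z))).
have [|h kh hy'] := wap_orbit_closure_pointwise Q'_compact
    (y := fun z => pi' (y' z)) (t := t) (F'_flow k).
  move=> s e e0; have [g' g'z] := r_imitation g s (@cts_quot_pi _ _ _ k) e0.
  by exists g' => z zs; rewrite quotient_flow_pi; exact: g'z.
exists h => // p.
pose kg p : R := k (lift_pi (phi g^-1%g p)).
apply: (@eq_on_closure _ _ (h \o lift_pi) kg (range y)).
- exact: Rhausdorff.
- exact: cts_lift_pi.
- move=> q; apply: (@continuous_comp _ _ _ (phi g^-1%g) (k \o lift_pi)).
    exact: flow_continuous.
  exact: cts_lift_pi.
- by move=> _ [z _ <-]; rewrite /kg /= y_act !lift_pi_y; exact: hy'.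
- exact: y_dense.
Qed.

Lemma ker_lift_pi_invariant : invariant_rel phi (ker_equiv lift_pi).
Proof.
have [_ [F'_inv F'_flow]] := F'_wap.
move=> g p q /ker_equivP pq; apply/ker_equivP.
apply: (cts_separate_points (R := R) Q'_compact Q'_haus) => k.
have [h _ hP] := lift_pi_translate F'_flow k g^-1%g.
by have := hP p; have := hP q; rewrite invgK => <- <-; rewrite pq.
Qed.

Lemma ker_lift_pi_wap : wap_quotient_rel R phi (ker_equiv lift_pi).
Proof.
have [_ [F'_inv F'_flow]] := F'_wap; split.
  rewrite (_ : mkset _ = [set xy | lift_pi xy.1 = lift_pi xy.2]).
    exact: closed_kernel lift_pi_continuous.
  by apply/seteqP; split=> xy /ker_equivP.
exists ker_lift_pi_invariant => f.
apply/wap_funP; first exact: quotient_compact.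
have [|k kf] := cts_factor_extension (R := R) Q'_compact Q'_haus
    (f := mkcts (@cts_quot_pi _ _ _ f)) Y_compact lift_pi_continuous.
  by move=> p q pq; congr (f _); apply/quot_piP/ker_equivP.
have k_james := wap_orbit_closure_james Q'_compact (F'_flow k).
apply: james_property_comp k_james _ => h' h'f.
have /choice[g gP] : forall n, exists g,
    translate (quotient_flow ker_lift_pi_invariant) g f = h' n.
  by move=> n; have [g _ gh] := h'f n; exists g.
have /choice[h /all_and2[kh hP]] : forall n, exists h,
    orbit_closure (quotient_flow F'_inv) k h /\
    forall p, h (lift_pi p) = k (lift_pi (phi (g n)^-1%g p)).
  by move=> n; apply/exists2P; exact: lift_pi_translate.
exists h, (lift_pi \o repr); split=> // n q.
by rewrite /= hP kf -gP -{1}(quot_pi_repr q) translate_quot_pi.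
Qed.

Lemma F_WAP_lift (F : equiv_rel Y) : is_F_WAP R phi F ->
  forall p q, F p q -> exists p' q', [/\ F' p' q', r p' = p & r q' = q].
Proof.
move=> [_ F_min] p q /(F_min _ ker_lift_pi_wap)/ker_equivP.
have [p' _ [<- ->]] := lift_piP p; have [q' _ [<- ->]] := lift_piP q.
by move=> /quot_piP pq; exists p', q'.
Qed.

End lift.

Section restrict.

Definition orbit_imitation :=
  forall (f : Y -> R) (s' : G') (s : {fset Z}) (e : R),
  continuous f -> 0 < e -> exists g : G, forall z, z \in s ->
    `|f (phi g^-1%g (y z)) - f (r (phi' s' (y' z)))| < e.

Definition countable_reflection := forall f' : Y' -> R, continuous f' ->
  exists (s' : G') (f : Y -> R), (forall p', f' p' = f (r (phi' s' p'))) /\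
    forall g' : nat -> G', exists (g : nat -> G) (theta : Y' -> Y),
    forall n p', f' (phi' (g' n)^-1%g p') = f (phi (g n)^-1%g (theta p')).

Hypotheses (r_imitation : orbit_imitation)
  (r_reflection : countable_reflection).
Context (F : equiv_rel Y) (F_wap : wap_quotient_rel R phi F).
Local Notation Q := (quotient_topology {eq_quot F}).
Local Notation CQ := (continuousType Q R).
Local Notation pi := (quot_pi F).

Let Q_compact : compact [set: Q] := quotient_compact Y_compact.
Let Q_haus : hausdorff_space Q := quotient_hausdorff R Y_compact Y_haus F_wap.1.

Definition orbit_pi (p' : Y') : G' -> Q := fun s' => pi (r (phi' s' p')).

Lemma ker_orbit_piP p' q' : ker_equiv orbit_pi p' q' <->
  forall s', pi (r (phi' s' p')) = pi (r (phi' s' q')).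
Proof.
rewrite ker_equivP; split=> [pq s'|pq]; last exact/funext.
exact: (congr1 (@^~ s') pq).
Qed.

Lemma orbit_pi_continuous s' : continuous (orbit_pi^~ s').
Proof.
move=> p'; apply: (@continuous_comp _ _ _ (phi' s') (pi \o r)).
  exact: flow_continuous.
by apply: continuous_comp; [exact: r_continuous|exact: quot_pi_continuous].
Qed.

Lemma ker_orbit_pi_invariant : invariant_rel phi' (ker_equiv orbit_pi).
Proof.
move=> g p q /ker_orbit_piP pq; apply/ker_orbit_piP => s'.
by rewrite -!flow_actM; exact: pq.
Qed.

Lemma ker_orbit_pi_lift p' q' : lift_closure p' -> lift_closure q' ->
  F (r p') (r q') -> ker_equiv orbit_pi p' q'.
Proof.
have [_ [F_inv F_flow]] := F_wap.
move=> Dp Dq /quot_piP pq; apply/ker_orbit_piP => s'.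
apply: (cts_separate_points (R := R) Q_compact Q_haus) => k.
have [|h _ hy] := wap_orbit_closure_pointwise Q_compact (y := fun z => pi (y z))
    (t := fun z => k (orbit_pi (y' z) s')) (F_flow k).
  move=> s e e0; have [g gz] := r_imitation s' s (@cts_quot_pi _ _ _ k) e0.
  by exists g => z zs; rewrite quotient_flow_pi; exact: gz.
have hD x : lift_closure x -> h (pi (r x)) = k (orbit_pi x s').
  apply: (@eq_on_closure _ _ (h \o pi \o r) (k \o orbit_pi^~ s')).
  - exact: Rhausdorff.
  - move=> z; apply: continuous_comp; first exact: r_continuous.
    exact: cts_quot_pi.
  - move=> z; apply: continuous_comp; first exact: orbit_pi_continuous.
    exact: cts_fun.
  - by move=> _ [z _ <-]; rewrite /= r_lift; exact: hy.
by rewrite -!hD// pq.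
Qed.

Lemma ker_orbit_pi_closed :
  closed [set xy : Y' * Y' | ker_equiv orbit_pi xy.1 xy.2].
Proof.
have -> : [set xy : Y' * Y' | ker_equiv orbit_pi xy.1 xy.2] =
    \bigcap_s' [set xy | orbit_pi xy.1 s' = orbit_pi xy.2 s'].
  apply/seteqP; split=> [xy /ker_orbit_piP pq s' _|xy pq]; first exact: pq.
  by apply/ker_orbit_piP => s'; exact: pq.
by apply: closed_bigI => s' _; exact: closed_kernel (@orbit_pi_continuous s').
Qed.

Lemma ker_orbit_pi_factor (f' : continuousType _ R) (s' : G') (f : Y -> R) :
  (forall p', f' (quot_pi (ker_equiv orbit_pi) p') = f (r (phi' s' p'))) ->
  exists k : CQ, forall p, k (pi p) = f p.
Proof.
move=> f'f.
pose f'_pi := f' \o quot_pi (ker_equiv orbit_pi).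
have f_restr p' : f (r p') = f'_pi (phi' s'^-1%g p').
  by rewrite /f'_pi /= f'f flow_actK.
have f_cts : continuous f.
  apply: (compact_factor_continuous lift_closure_compact Y_haus r_continuous
    lift_closure_surj (g := f'_pi \o phi' s'^-1%g)) => //.
  move=> x; apply: (@continuous_comp _ _ _ (phi' s'^-1%g)).
    exact: flow_continuous.
  exact: cts_quot_pi.
apply: (cts_factor_extension (f := mkcts f_cts) Q_compact Q_haus Y_compact).
  exact: quot_pi_continuous.
move=> p q /quot_piP; have [p' Dp <-] := lift_closure_surj p.
have [q' Dq <-] := lift_closure_surj q => pq.
change (f (r p') = f (r q')); rewrite !f_restr.
by congr (f' _); apply/quot_piP/ker_orbit_pi_invariant/ker_orbit_pi_lift.
Qed.

Lemma ker_orbit_pi_wap : wap_quotient_rel R phi' (ker_equiv orbit_pi).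
Proof.
have [_ [F_inv F_flow]] := F_wap; split; first exact: ker_orbit_pi_closed.
exists ker_orbit_pi_invariant => f'.
apply/wap_funP; first exact: quotient_compact.
have [s' [f [f'f fg]]] := r_reflection (@cts_quot_pi _ _ _ f').
have [k kf] := ker_orbit_pi_factor f'f.
have k_james := wap_orbit_closure_james Q_compact (F_flow k).
apply: james_property_comp k_james _ => h' h'f.
have /choice[g' g'P] : forall n, exists g',
    translate (quotient_flow ker_orbit_pi_invariant) g' f' = h' n.
  by move=> n; have [g _ gh] := h'f n; exists g.
have [g [theta gtheta]] := fg g'.
exists (fun n => translate (quotient_flow F_inv) (g n) k).
exists (pi \o theta \o repr).
split=> [n|n q]; first exact: sub_orbit_closure.
rewrite /= translate_quot_pi kf -gtheta -g'P.
by rewrite -{1}(quot_pi_repr q) translate_quot_pi.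
Qed.

Lemma F_WAP_restrict (F' : equiv_rel Y') : is_F_WAP R phi' F' ->
  forall p' q', F' p' q' -> F (r p') (r q').
Proof.
move=> [_ F'_min] p' q' /(F'_min _ ker_orbit_pi_wap)/ker_orbit_piP/(_ 1%g).
by rewrite !flow_act1 => /quot_piP.
Qed.

End restrict.
End factor_map.

(** * Formulas and saturated models *)

Lemma card_leT_inj (T U : Type) (f : T -> U) : injective f ->
  ([set: T] #<= [set: U])%card.
Proof.
move=> f_inj; rewrite -(card_le_eql (inj_card_eq (f := f) _)) ?card_leT//.
by move=> x y _ _; exact: f_inj.
Qed.

Lemma card_le_add_countType (P : countType) (I : Type) :
  ([set: I + P] #<= [set: nat + I])%card.
Proof.
apply: (card_leT_inj (f := fun x : I + P =>
  match x with inl i => inr i | inr k => inl (choice.pickle k) end)).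
by move=> [i|k] [i'|k'] // [] => [->|/(pcan_inj choice.pickleK) ->].
Qed.

Lemma card_le_countType (P : countType) (I : Type) :
  ([set: P] #<= [set: nat + I])%card.
Proof.
apply: card_le_trans (card_le_add_countType P I).
by apply: (card_leT_inj (f := inr)) => k k' [].
Qed.

Lemma countable_sub_range (T : Type) (A : set T) : inhabited T -> countable A ->
  exists c : nat -> T, A `<=` range c.
Proof.
move=> [x0] /pfcard_geP[->|[f]]; first by exists (fun=> x0).
by exists f; exact: surj.
Qed.

Lemma finite_subset_chain (T : Type) (F : set (set T)) (A : set T) :
  F !=set0 -> total_on F subset -> finite_set A -> A `<=` \bigcup_(X in F) X ->
  exists2 X, F X & A `<=` X.
Proof.
move=> F0 Ftot [n]; elim: n A => [|n IH] A.
  by rewrite II0 card_eq0 => /eqP -> _; have [X FX] := F0; exists X.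
move=> /eq_cardSP[x Ax /IH {}IH] AF; have [X FX Xx] := AF x Ax.
have [y [Ay _]|X' FX' AX'] := IH; first exact: AF.
have AE y : A y -> y <> x -> X' y by move=> Ay yx; apply: AX'.
have [XX'|X'X] := Ftot _ _ FX FX'.
  exists X' => // y Ay.
  by have [->|/(AE y Ay)] := pselect (y = x); first exact: XX'.
by exists X => // y Ay; have [->|/(AE y Ay)/X'X] := pselect (y = x).
Qed.

Section formulas.
Context (L : language).

Lemma family_finite_support (V : Type) (n : nat) (ts : 'I_n -> term L V) :
  (forall i, exists (W : finType) (h : W -> V) u, ts i = trename h u) ->
  exists (W : finType) (h : W -> V) us, ts = trename h \o us.
Proof.
move=> ts_fin.
have /choice[F tsE] : forall i,
    exists F : {W : finType & (W -> V) * term L W}%type,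
    ts i = trename (tagged F).1 (tagged F).2.
  by move=> i; have [W [h [u ->]]] := ts_fin i; exists (existT _ W (h, u)).
exists {i & tag (F i)}, (fun x => (tagged (F (tag x))).1 (tagged x)).
exists (fun i => trename (existT (fun i => tag (F i)) i) (tagged (F i)).2).
by apply/funext => i; rewrite /= trename_comp tsE.
Qed.

Lemma term_finite_support (V : Type) (t : term L V) :
  exists (W : finType) (h : W -> V) u, t = trename h u.
Proof.
elim: t => [x|f ts /family_finite_support[W [h [us ->]]]].
  by exists unit, (fun=> x), (Var L tt).
by exists W, h, (App us).
Qed.

Lemma formula_finite_support (V : Type) (phi : formula L V) :
  exists (W : finType) (h : W -> V) psi, phi = rename h psi.
Proof.
elim: phi => {V} [V t u|V r ts|V|
    V phi [W [h [phi' ->]]] psi [W' [h' [psi' ->]]]|V phi [W [h [psi ->]]]].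
- have [W [h [t' ->]]] := term_finite_support t.
  have [W' [h' [u' ->]]] := term_finite_support u.
  exists (W + W')%type, (sum_rect _ h h').
  exists (Eq (trename inl t') (trename inr u')).
  by rewrite /= !trename_comp.
- have [W [h [us ->]]] :=
    family_finite_support (fun i => term_finite_support (ts i)).
  by exists W, h, (Rel us).
- by exists void, (of_void V), Bot.
- exists (W + W')%type, (sum_rect _ h h').
  exists (Imp (rename inl phi') (rename inr psi')).
  by rewrite /= !rename_comp.
have /choice[k hk] : forall w : {w | isSome (h w)},
    exists v, h (val w) = Some v.
  by case=> w /=; case: (h w) => // v _; exists v.
exists {w | isSome (h w)}, k, (All (rename insub psi)).
rewrite /= rename_comp; congr (All (rename _ psi)); apply/funext => w /=.
by case: insubP => [w' _ <-|]; [rewrite /= -hk|case: (h w)].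
Qed.

Lemma elementary_sat (M N : structure L) (j : M -> N) (V : Type) (v : V -> M)
    (phi : formula L V) : elementary j -> sat v phi <-> sat (j \o v) phi.
Proof.
move=> j_elem; have := j_elem (rename v phi).
by rewrite !sat_rename.
Qed.

Lemma elementary_realize (M N : structure L) (j : M -> N) (V P : Type)
    (c : P -> M) (a : V -> N) (phi : formula L (V + P)) : elementary j ->
  sat (assign a (j \o c)) phi -> exists b : V -> M, sat (assign b c) phi.
Proof.
move=> j_elem a_phi; have [s [s_fin s_supp]] := sat_support N phi.
have [m] := carrier_inhabited M.
pose s' := s `&` range inl; pose v : V + P -> M := assign (fun=> m) c.
pose w x := if `[< s' x >] then assign a (j \o c) x else j (v x).
have [|||u [uv u_phi]] := @sat_exists_vars _ _ _ j _ phi v w s' j_elem.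
- exact: finite_setIl.
- by move=> x sx; rewrite /w; case: asboolP.
- rewrite (s_supp w (assign a (j \o c))) // => x sx.
  rewrite /w; case: asboolP => //.
  by case: x sx => [i|k] //= sx []; split => //; exists i.
exists (u \o inl); congr (sat _ phi): u_phi; apply/funext => -[//|k].
by apply: uv => -[_ []].
Qed.

Lemma exists_vars_formula (V : Type) (s : set V) (phi : formula L V) :
  finite_set s -> exists psi, forall (M : structure L) (w : V -> M),
    sat w psi <->
    exists u : V -> M, (forall x, ~ s x -> u x = w x) /\ sat u phi.
Proof.
case=> n; elim: n s => [s|n IH s /eq_cardSP[x sx /IH[psi psiP]]].
  rewrite II0 card_eq0 => /eqP ->; exists phi => M w.
  split=> [wphi|[u [uw u_phi]]]; first by exists w.
  by congr (sat _ phi): u_phi; apply/funext => x; rewrite uw.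
exists (exists_var x psi) => M w; rewrite sat_exists_var; split.
  move=> [w' [w'w /psiP[u [uw' u_phi]]]]; exists u; split=> // y ny.
  rewrite uw' ?w'w//; first by move=> yx; apply: ny; rewrite yx.
  by move=> [].
move=> [u [uw u_phi]].
exists (fun y => if `[< y = x >] then u x else w y); split.
  by move=> y yx; case: asboolP.
apply/psiP; exists u; split=> // y ny; case: asboolP => [->//|yx].
by apply: uw => sy; apply: ny.
Qed.

Lemma projection_formula (M : structure L) (V P : Type) (v : V)
    (phi : formula L (V + P)) :
  exists chi : formula L (unit + P), forall (b : M) (c : P -> M),
    sat (assign (fun=> b) c) chi <-> exists2 a, a v = b & sat (assign a c) phi.
Proof.
have [s [s_fin s_supp]] := sat_support M phi.
pose s' := s `&` [set inl w | w in [set w | w <> v]].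
have s'_fin : finite_set s' by exact: finite_setIl.
have [psi psiP] := exists_vars_formula phi s'_fin.
pose to_unit (x : V + P) : unit + P := if x is inr k then inr k else inl tt.
exists (rename to_unit psi) => b c; rewrite sat_rename psiP; split.
  move=> [u [uw u_phi]]; exists (u \o inl).
    by rewrite /= uw// => -[_ [w wv [] /wv]].
  congr (sat _ phi): u_phi; apply/funext => -[//|k].
  by rewrite uw// => -[_ []].
move=> [a av a_phi]; pose w := assign (fun=> b) c \o to_unit.
exists (fun x => if `[< s' x >] then assign a c x else w x).
split; first by move=> x sx; case: asboolP.
rewrite (s_supp _ (assign a c))// => x sx; case: asboolP => //.
case: x sx => [x|//] sx ns; rewrite /w /= -av; congr a.
by apply: contrapT => vx; apply: ns; split=> //; exists x => // /esym.
Qed.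

End formulas.

Section saturated_realization.
Context (L : language) (M : structure L) (K : Type).
Hypothesis M_sat : succ_saturated M K.

Lemma saturated_realize1 (Q : Type) (d : Q -> M)
    (p : set (formula L (unit + Q))) :
  (range d #<= [set: K])%card -> finsat d p ->
  exists b : M, p `<=` [set phi | sat (assign (fun=> b) d) phi].
Proof.
move=> d_card p_fin.
pose to_range (q : Q) : set_type (range d) := SigSub (mem_set (imageT d q)).
have sat_to_range (a : unit -> M) phi :
    sat (assign a (fun x : set_type (range d) => val x))
      (rename (inr_map to_range) phi) <-> sat (assign a d) phi.
  have -> : assign a d = assign a (fun x => val x) \o inr_map to_range.
    by apply/funext => -[].
  exact: sat_rename.
have [|b bP] := M_sat d_card (p := rename (inr_map to_range) @` p).
  move=> q q_fin q_sub.
  have /choice[f fP] : forall psi, exists phi, q psi ->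
      p phi /\ rename (inr_map to_range) phi = psi.
    move=> psi; have [/q_sub[phi pphi <-]|nq] := pselect (q psi).
      by exists phi.
    by exists Bot.
  have [||a aP] := p_fin (f @` q); first exact: finite_image.
    by move=> _ [psi qpsi <-]; have [] := fP psi qpsi.
  exists a => psi qpsi; have [_ <-] := fP psi qpsi.
  by apply/sat_to_range; apply: aP; exists psi.
by exists b => phi pphi; apply/sat_to_range; apply: bP; exists phi.
Qed.

Section partial_realization.
Context (V P : Type) (c : P -> M) (p : set (formula L (V + P))).
Hypothesis VP_card : ([set: V + P] #<= [set: K])%card.
Implicit Types (Gr : set (V * M)) (q : set (formula L (V + P))).

(* [Gr] is the graph of a partial assignment, the form used by [Zorn_bigcup]. *)
Definition extends Gr (a : V -> M) := forall v b, Gr (v, b) -> a v = b.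

Definition finsat_over Gr := forall q, finite_set q -> q `<=` p ->
  exists2 a, extends Gr a & q `<=` [set phi | sat (assign a c) phi].

Definition extends_sat Gr v q b := exists a,
  [/\ a v = b, extends Gr a & q `<=` [set phi | sat (assign a c) phi]].

Lemma extension_formula Gr (a0 : V -> M) (v : V) q : extends Gr a0 ->
  (forall b, ~ Gr (v, b)) -> finite_set q ->
  exists chi : formula L (unit + (V + P)), forall b,
    sat (assign (fun=> b) (assign a0 c)) chi <-> extends_sat Gr v q b.
Proof.
move=> a0_Gr v_free q_fin; have [Phi PhiP] := finite_conj q_fin.
pose dom w := exists b, Gr (w, b).
pose fix_dom (x : V + P) : V + (V + P) :=
  match x with
  | inl w => if `[< dom w >] then inr (inl w) else inl w
  | inr k => inr (inr k)
  end.
have [chi chiP] := projection_formula M v (rename fix_dom Phi).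
exists chi => b; rewrite chiP; split=> [[a av]|[a [av a_Gr /PhiP a_Phi]]].
  rewrite sat_rename => a_Phi.
  exists (fun w => if `[< dom w >] then a0 w else a w); split.
  - by case: asboolP => // -[b' /v_free].
  - by move=> w b' wb'; case: asboolP => [_|[]]; [exact: a0_Gr|exists b'].
  - apply/PhiP; congr (sat _ Phi): a_Phi.
    by apply/funext => -[w|//] /=; case: asboolP.
exists a => //; rewrite sat_rename; congr (sat _ Phi): a_Phi.
apply/funext => -[w|//] /=; case: asboolP => // -[b' wb'] /=.
by rewrite (a_Gr w b')// (a0_Gr w b').
Qed.

Lemma finsat_over_extend Gr v : finsat_over Gr ->
  exists b, finsat_over (Gr `|` [set (v, b)]).
Proof.
move=> Gr_fin; have [[b vb]|/forallNP v_free] := pselect (exists b, Gr (v, b)).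
  by exists b; rewrite setUidl// => _ ->.
have [a0 a0_Gr _] := Gr_fin set0 (finite_set0 _) (@sub0set _ p).
have /choice[chi chiP] : forall q, exists chi : formula L (unit + (V + P)),
    finite_set q -> forall b,
    sat (assign (fun=> b) (assign a0 c)) chi <-> extends_sat Gr v q b.
  move=> q; have [/(extension_formula a0_Gr v_free)[chi chiP]|] :=
    pselect (finite_set q); [by exists chi|by exists Bot].
pose fin_sub q := finite_set q /\ q `<=` p.
have [||b bP] := saturated_realize1 (d := assign a0 c) (p := chi @` fin_sub).
- exact: card_le_trans (card_image_le _ _) VP_card.
- move=> Q Q_fin Q_sub.
  have /choice[f fP] : forall psi, exists q, Q psi -> fin_sub q /\ chi q = psi.
    move=> psi; have [/Q_sub[q qP <-]|nQ] := pselect (Q psi); first by exists q.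
    by exists set0.
  have [||a a_Gr aP] := Gr_fin (\bigcup_(psi in Q) f psi).
  + by apply: bigcup_finite => // psi /fP[[]].
  + by apply: bigcup_sub => psi /fP[[]].
  exists (fun=> a v) => psi Qpsi; have [[f_fin _] <-] := fP psi Qpsi.
  apply/(chiP _ f_fin); exists a; split=> // phi fphi.
  by apply: aP; exists psi.
exists b => q q_fin q_sub; have /(chiP q q_fin)[a [av a_Gr aq]] :
    sat (assign (fun=> b) (assign a0 c)) (chi q) by apply: bP; exists q.
by exists a => // w b' [/a_Gr//|[-> ->]].
Qed.

Lemma finsat_over_chain_functional (F : set (set (V * M))) v b b' :
  F `<=` finsat_over -> total_on F subset ->
  (\bigcup_(X in F) X) (v, b) -> (\bigcup_(X in F) X) (v, b') -> b = b'.
Proof.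
move=> F_fin Ftot vb vb'; have [X0 FX0 _] := vb.
have [|X /F_fin X_fin Xvb] := finite_subset_chain (ex_intro _ X0 FX0) Ftot
    (finite_set2 (v, b) (v, b')).
  by move=> _ [->|->].
have [a aX _] := X_fin set0 (finite_set0 _) (@sub0set _ p).
by rewrite -(aX v b) ?(aX v b')//; apply: Xvb; [right|left].
Qed.

Lemma finsat_over_chain (F : set (set (V * M))) : finsat c p ->
  F `<=` finsat_over -> total_on F subset -> finsat_over (\bigcup_(X in F) X).
Proof.
move=> p_fin F_fin Ftot q q_fin q_sub; set U := \bigcup_(X in F) X.
have [F0|/set0P F0] := eqVneq F set0.
  have [a aq] := p_fin q q_fin q_sub; exists a => // v b [X].
  by rewrite F0.
have /choice[g gP] : forall v, exists b, forall b', U (v, b') -> b' = b.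
  move=> v; have [[b vb]|nvb] := pselect (exists b, U (v, b)).
    by exists b => b' vb'; exact: finsat_over_chain_functional vb' vb.
  by have [m] := carrier_inhabited M; exists m => b' vb'; case: nvb; exists b'.
have [Phi PhiP] := finite_conj q_fin.
have [s [s_fin s_supp]] := sat_support M Phi.
pose A := U `&` [set (w, g w) | w in inl @^-1` s].
have [||X FX AX] := finite_subset_chain F0 Ftot (_ : finite_set A).
- by apply/finite_setIr/finite_image/finite_preimage => // v w _ _ [].
- by move=> x [].
have [a aX /PhiP a_Phi] := F_fin X FX q q_fin q_sub.
exists (fun w => if `[< U (w, g w) >] then g w else a w).
  by move=> v b vb; rewrite -(gP v b vb) asboolT.
apply/PhiP; rewrite (s_supp _ (assign a c))// => -[w|//] sw /=.
by case: asboolP => // Uw; apply/esym/aX/AX; split=> //; exists w.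
Qed.

End partial_realization.

Lemma saturated_realize (V P : Type) (c : P -> M)
    (p : set (formula L (V + P))) :
  ([set: V + P] #<= [set: K])%card -> finsat c p ->
  exists a : V -> M, p `<=` [set phi | sat (assign a c) phi].
Proof.
move=> VP_card p_fin.
have [Gr [Gr_fin Gr_max]] : exists Gr, finsat_over c p Gr /\
    forall Gr', Gr `<` Gr' -> ~ finsat_over c p Gr'.
  by apply: Zorn_bigcup => F; exact: finsat_over_chain.
have /choice[a aP] : forall v, exists b, Gr (v, b).
  move=> v; have [b b_fin] := finsat_over_extend VP_card v Gr_fin; exists b.
  apply: contrapT => nGr; apply: Gr_max b_fin; split; first exact: subsetUl.
  by move=> /(_ (v, b)) sub; apply: nGr; apply: sub; right.
exists a => phi pphi.
have [||a' a'_Gr a'P] := Gr_fin [set phi]; first exact: finite_set1.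
  by move=> _ ->.
have -> : a = a' by apply/funext => v; rewrite (a'_Gr v (a v)).
exact: a'P.
Qed.

Lemma saturated_reflect (N : structure L) (j : M -> N) (V P : Type) (c : P -> M)
    (a' : V -> N) : elementary j -> ([set: V + P] #<= [set: K])%card ->
  exists a : V -> M, forall psi : formula L (V + P),
    sat (assign a c) psi <-> sat (assign a' (j \o c)) psi.
Proof.
move=> j_elem VP_card.
pose p := [set psi : formula L (V + P) | sat (assign a' (j \o c)) psi].
have p_fin : finsat c p.
  move=> q /finite_conj[Phi PhiP] q_sub.
  have [a /PhiP a_q] : exists a, sat (assign a c) Phi.
    by apply: (elementary_realize (a := a') j_elem); apply/PhiP => psi /q_sub.
  by exists a.
have [a aP] := saturated_realize VP_card p_fin.
exists a => psi; split=> [a_psi|]; last exact: aP.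
by apply: contrapT => npsi; exact: (aP (Neg psi) npsi).
Qed.

End saturated_realization.

Lemma homogeneous_tuple (L : language) (M : structure L) (K P : Type)
    (c d : P -> M) :
  succ_strongly_homogeneous M K -> ([set: P] #<= [set: K])%card ->
  (forall phi : formula L P, sat c phi <-> sat d phi) ->
  exists g : aut M, g \o c = d.
Proof.
move=> M_hom P_card cd.
have /choice[sec secP] : forall x : set_type (range c), exists k, c k = val x.
  by move=> x; have [k _ kx] := set_valP x; exists k.
have c_card := card_le_trans (card_image_le c setT) P_card.
have [|g gP] := M_hom _ c_card (d \o sec).
  move=> phi; rewrite -!(sat_rename sec) -cd sat_rename.
  by rewrite (_ : c \o sec = fun x => val x)//; apply/funext => x; exact: secP.
exists g; apply/funext => k; pose ck := SigSub (mem_set (imageT c k)).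
rewrite -[LHS]/(g (val ck)) gP.
exact: (cd (Eq (Var L (sec ck)) (Var L k))).1 (secP ck).
Qed.

(** * Type spaces *)

Section instances.
Context (L : language) (I M : Type).

Definition instance (J P : Type) (i : J -> I) (d : P -> M)
  (psi : formula L (J + P)) : formula L (I + M) :=
  rename (assign (inl \o i) (inr \o d)) psi.

Lemma instance_comp (J J' P P' : Type) (i : J -> I) (d : P -> M)
    (f : J' -> J) (g : P' -> P) psi :
  instance (i \o f) (d \o g) psi =
  instance i d (rename (assign (inl \o f) (inr \o g)) psi).
Proof.
by rewrite /instance rename_comp; congr rename; apply/funext => -[].
Qed.

Lemma sum_finType_split (W : finType) (h : W -> I + M) :
  exists (J P : finType) (i : J -> I) (d : P -> M) (k : W -> J + P),
    h = assign (inl \o i) (inr \o d) \o k.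
Proof.
pose is_var w := if h w is inl _ then true else false.
have /choice[i hi] : forall w : {w | is_var w}, exists x, h (val w) = inl x.
  by case=> w; rewrite /is_var /=; case: (h w) => // x _; exists x.
have /choice[d hd] : forall w : {w | ~~ is_var w}, exists b, h (val w) = inr b.
  by case=> w; rewrite /is_var /=; case: (h w) => // b _; exists b.
have /choice[k hk] : forall w, exists x, h w = assign (inl \o i) (inr \o d) x.
  move=> w; case: (boolP (is_var w)) => wP.
    by exists (inl (Sub w wP)); rewrite /= -hi.
  by exists (inr (Sub w wP)); rewrite /= -hd.
by exists {w | is_var w}, {w | ~~ is_var w}, i, d, k; apply/funext.
Qed.

Lemma fset_instance (s : {fset formula L (I + M)}) :
  exists (J P : finType) (i : J -> I) (d : P -> M),
    forall phi, phi \in s -> exists psi, phi = instance i d psi.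
Proof.
have /choice[S phiS] : forall phi : formula L (I + M),
    exists S : {W : finType & (W -> I + M) * formula L W}%type,
    phi = rename (tagged S).1 (tagged S).2.
  move=> phi; have [W [h [psi ->]]] := formula_finite_support phi.
  by exists (existT _ W (h, psi)).
pose var (x : {phi : s & tag (S (val phi))}) : I + M :=
  (tagged (S (val (tag x)))).1 (tagged x).
have [J [P [i [d [k kE]]]]] := sum_finType_split var.
exists J, P, i, d => phi phis.
pose x_in := existT (fun phi : s => tag (S (val phi))) [` phis]%fset.
exists (rename (k \o x_in) (tagged (S phi)).2).
rewrite /instance rename_comp {1}(phiS phi); congr rename.
by apply/funext => w; rewrite compA -kE.
Qed.

End instances.

Section type_topology.
Context (L : language) (M : structure L) (I : Type) (pi : set (formula L I)).
Local Notation S := (type_space M pi).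
Implicit Types (p q : S) (phi : formula L (I + M)).

Lemma type_neg p phi : p (Neg phi) <-> ~ p phi.
Proof.
split=> [pN pP|nP]; last by have [|] := type_complete p phi.
have [||a aP] := @type_finsat _ _ _ _ p [set phi; Neg phi].
- exact: finite_set2.
- by move=> psi [->|->].
have := aP (Neg phi) (or_intror erefl); apply.
exact: (aP phi (or_introl erefl)).
Qed.

Lemma type_sub_eq p q : (forall phi, p phi -> q phi) -> p = q.
Proof.
move=> pq; apply: type_space_eq => phi; split=> [/pq //|qphi].
by apply: contrapT => /type_neg/pq/type_neg.
Qed.

Lemma open_formula phi : open [set p : S | p phi].
Proof.
exists [set [set p : S | p phi]]; last by rewrite bigcup_set1.
move=> _ ->; exists [fset phi]%fset; first by move=> ? _; rewrite inE.
apply/seteqP; split=> [p pP|p pP psi]; first by apply: pP => /=; rewrite inE.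
by rewrite /= inE => /eqP->.
Qed.

Lemma nbhs_formula p phi : p phi -> nbhs p [set q : S | q phi].
Proof.
by move=> pphi; apply: open_nbhs_nbhs; split=> //; exact: open_formula.
Qed.

Lemma nbhs_typeP p (A : set S) :
  nbhs p A <-> exists s : {fset formula L (I + M)},
  (forall phi, phi \in s -> p phi) /\
  forall q, (forall phi, phi \in s -> q phi) -> A q.
Proof.
split=> [|[s [sp sA]]].
  rewrite nbhsE => -[B [[D DI <-] [C DC Cp]] BA].
  have [s _ sC] := DI _ DC; exists s; split=> [phi phis|q qs].
    by move: Cp; rewrite -sC; apply.
  by apply: BA; exists C => //; change (C q); rewrite -sC => phi; exact: qs.
have : nbhs p (\bigcap_(phi in [set` s]) [set q : S | q phi]).
  by apply: filter_bigI => phi phis; exact/nbhs_formula/sp.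
by apply: filterS => q qs; apply: sA => phi; exact: qs.
Qed.

Lemma type_space_hausdorff : hausdorff_space S.
Proof.
move=> p q pq; apply: type_sub_eq => phi pphi.
apply: contrapT => /type_neg/nbhs_formula qN.
by have [u [uphi /type_neg]] := pq _ _ (nbhs_formula pphi) qN.
Qed.

Lemma type_space_compact : compact [set: S].
Proof.
rewrite compact_ultra => U UU _.
have UP : ProperFilter U by exact: ultra_proper.
pose t phi := U [set p : S | p phi].
have tI (s : {fset formula L (I + M)}) : (forall phi, phi \in s -> t phi) ->
    U (\bigcap_(phi in [set` s]) [set p : S | p phi]).
  by move=> st; apply: filter_bigI => phi phis; exact: st.
have tfin : finsat (fun c : M => c) t.
  move=> q /finite_fsetP[s ->] /tI/filter_ex[p pP].
  by apply: (@type_finsat _ _ _ _ p) => [|phi /pP//]; exact: finite_fset.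
have tcompl phi : t phi \/ t (Neg phi).
  have [|UN] := in_ultra_setVsetC [set p : S | p phi] UU; first by left.
  by right; apply: filterS UN => p /= /type_neg.
have text (phi : formula L I) : pi phi -> t (rename inl phi).
  by move=> piphi; apply: filterS filterT => p _; exact: type_extends.
exists (TypeSpace tfin tcompl text); split=> // A /nbhs_typeP[s [/tI sp sA]].
by apply: filterS sp => q qP; apply: sA => phi phis; exact: qP.
Qed.

Definition agree_over (J P : Type) (i : J -> I) (d : P -> M) p q :=
  forall psi, p (instance i d psi) <-> q (instance i d psi).

Lemma finite_determination (R : realType) (f : S -> R) (e : R) : continuous f ->
  0 < e -> exists (J P : finType) (i : J -> I) (d : P -> M),
    forall p q, agree_over i d p q -> `|f p - f q| < e.
Proof.
move=> f_cts e0; pose determined (s : {fset formula L (I + M)}) p :=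
  forall q, (forall phi, phi \in s -> p phi <-> q phi) -> `|f p - f q| < e.
have : \forall s \near fset_directed, [set: S] `<=` determined s.
  move/compact_near_coveringP: type_space_compact; apply=> p0 _.
  have /nbhs_typeP[s0 [p0s s0P]] : nbhs p0 [set q | `|f p0 - f q| < e / 2].
    by have /cvgrPdist_lt := f_cts p0; apply; rewrite divr_gt0.
  exists ([set p : S | forall phi, phi \in s0 -> p phi],
          [set s | (s0 `<=` s)%fset]); first split => /=.
  - by apply/nbhs_typeP; exists s0.
  - by exists s0.
  move=> [p s] [/= ps0 /fsubsetP s0s] q pq.
  have qs0 phi : phi \in s0 -> q phi.
    by move=> phis; apply/pq; [exact: s0s|exact: ps0].
  have := s0P p ps0; have /= := s0P q qs0.
  by rewrite !ltr_norml; lra.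
move=> /filter_ex[s s_det]; have [J [P [i [d s_inst]]]] := fset_instance s.
exists J, P, i, d => p q pq; apply: s_det => // phi /s_inst[psi ->].
exact: pq.
Qed.

Lemma countable_determination (R : realType) (f : S -> R) : continuous f ->
  exists c : nat -> M, forall p q, agree_over id c p q -> f p = f q.
Proof.
move=> f_cts.
have /choice[D /all_and2[D_fin D_det]] : forall n, exists D : set M,
    finite_set D /\ forall c : nat -> M, D `<=` range c ->
    forall p q, agree_over id c p q -> `|f p - f q| < n.+1%:R^-1.
  move=> n; have n0 : 0 < n.+1%:R^-1 :> R by rewrite invr_gt0.
  have [J [P [i [d dP]]]] := finite_determination f_cts n0.
  exists (range d); split=> [|c dc p q pq].
    by apply: finite_image; exact: finite_finset.
  have /choice[k ck] : forall x, exists n, c n = d x.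
    by move=> x; have [m _ cm] := dc (d x) (imageT d x); exists m.
  apply: dP => psi; rewrite (_ : d = c \o k); last by apply/funext => x /=.
  by rewrite -[i]/(id \o i) instance_comp; exact: pq.
have [|c Dc] := countable_sub_range (A := \bigcup_n D n) (carrier_inhabited M).
  by apply: bigcup_countable => // n _; exact/finite_set_countable/D_fin.
exists c => p q pq; apply/eqP; rewrite -subr_eq0 -normr_le0.
apply/ler_addgt0Pr => e e0; rewrite add0r.
have [n _ /(_ n (leqnn n)) ne] := near_infty_natSinv_lt (PosNum e0).
apply: ltW; apply: lt_trans ne; apply: D_det pq => x Dx.
by apply: Dc; exists n.
Qed.

Definition realized_type (a : I -> M)
  (ha : forall phi : formula L I, pi phi -> sat a phi) : S.
Proof.
exists [set phi | sat (assign a (fun c : M => c)) phi].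
- by move=> q _ qa; exists a.
- by move=> phi; exact: (EM (sat _ phi)).
- by move=> phi piphi /=; rewrite sat_rename; exact: ha.
Defined.

Lemma realized_instance a ha (J P : Type) (i : J -> I) (d : P -> M) psi :
  @realized_type a ha (instance i d psi) <-> sat (assign (a \o i) d) psi.
Proof.
rewrite /= sat_rename (_ : _ \o _ = assign (a \o i) d)//.
by apply/funext => -[].
Qed.

Lemma type_act_instance (g : aut M) p (J P : Type) (i : J -> I) (d : P -> M)
    psi :
  type_flow M pi g p (instance i d psi) <-> p (instance i (aut_inv g \o d) psi).
Proof.
rewrite /= rename_comp; set h := _ \o _.
by rewrite (_ : h = assign (inl \o i) (inr \o (aut_inv g \o d)))//;
  apply/funext => -[].
Qed.

Lemma type_actV_instance (g : aut M) p (J P : Type) (i : J -> I) (d : P -> M)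
    psi :
  type_flow M pi g^-1%g p (instance i d psi) <-> p (instance i (g \o d) psi).
Proof. exact: type_act_instance. Qed.

End type_topology.

Section type_restriction.
Context (L : language) (M N : structure L) (j : M -> N) (j_elem : elementary j).
Context (I : Type) (pi : set (formula L I)).
Local Notation restr := (@type_restr L M N j j_elem I pi).

Lemma type_restr_instance p (J P : Type) (i : J -> I) (d : P -> M) psi :
  restr p (instance i d psi) <-> p (instance i (j \o d) psi).
Proof.
rewrite /= rename_comp (_ : _ \o _ = assign (inl \o i) (inr \o (j \o d)))//.
by apply/funext => -[].
Qed.

Lemma type_restr_continuous : continuous restr.
Proof.
move=> p A /nbhs_typeP[s [sp sA]].
apply/nbhs_typeP; exists [fset rename (inr_map j) phi | phi in s]%fset.
split=> [_ /imfsetP[phi phis ->]|q qs]; first exact: sp.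
by apply: sA => phi phis; apply: qs; exact: in_imfset.
Qed.

End type_restriction.

(** * An elementary pair of saturated models *)

Section elementary_pair.
Context (R : realType) (L : language) (C C' : structure L) (j : C -> C').
Context (I : Type) (pi : set (formula L I)).
Hypotheses (j_elem : elementary j) (C_sat : succ_saturated C (nat + I))
  (C_hom : succ_strongly_homogeneous C (nat + I))
  (C'_hom : succ_strongly_homogeneous C' (nat + I)).
Local Notation S := (type_space C pi).
Local Notation S' := (type_space C' pi).
Local Notation phi := (type_flow C pi).
Local Notation phi' := (type_flow C' pi).
Local Notation r := (@type_restr L C C' j j_elem I pi).

Lemma reflect_tuple (V P : countType) (a' : V -> C') (c : P -> C) :
  exists a : V -> C, forall psi : formula L (P + V),
    sat (assign c a) psi <-> sat (assign (j \o c) a') psi.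
Proof.
have VP_card := card_le_countType (V + P)%type I.
have [a aP] := saturated_reflect C_sat c a' j_elem VP_card.
exists a => psi; pose swap (x : P + V) : V + P := assign inr inl x.
have := aP (rename swap psi); rewrite !sat_rename.
by congr iff; congr (sat _ psi); apply/funext => -[].
Qed.

Lemma reflect_plain (V : countType) (a' : V -> C') : exists a : V -> C,
  forall psi : formula L V, sat a psi <-> sat a' psi.
Proof.
have [a aP] := reflect_tuple a' (of_void C).
by exists a => psi; have := aP (rename inr psi); rewrite !sat_rename.
Qed.

Lemma homogeneous_countable (M : structure L) (P : countType) (c d : P -> M) :
  succ_strongly_homogeneous M (nat + I) ->
  (forall psi : formula L P, sat c psi <-> sat d psi) ->
  exists g : aut M, g \o c = d.
Proof.
by move=> M_hom; apply: homogeneous_tuple M_hom (card_le_countType P I).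
Qed.

Definition solution := {a : I -> C | forall psi, pi psi -> sat a psi}.

HB.instance Definition _ := gen_eqMixin solution.
HB.instance Definition _ := gen_choiceMixin solution.

Implicit Types z : solution.

Lemma solution_lift z psi : pi psi -> sat (j \o sval z) psi.
Proof. by move=> /(svalP z); rewrite (elementary_sat _ _ j_elem). Qed.

Lemma solution_act_subproof (g : aut C) z psi : pi psi -> sat (g \o sval z) psi.
Proof. by move=> /(svalP z); rewrite sat_aut. Qed.

Definition solution_act (g : aut C) z : solution :=
  exist _ (g \o sval z) (@solution_act_subproof g z).

Definition solution_type z : S := realized_type (svalP z).
Definition lifted_type z : S' := realized_type (@solution_lift z).

Lemma restr_lifted_type z : r (lifted_type z) = solution_type z.
Proof.
apply: type_sub_eq => psi /=; rewrite sat_rename (elementary_sat _ _ j_elem).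
by congr (sat _ psi); apply/funext => -[].
Qed.

Lemma act_solution_type g z :
  phi g (solution_type z) = solution_type (solution_act g z).
Proof.
apply: type_sub_eq => psi /=; rewrite sat_rename -(sat_aut g).
by congr (sat _ psi); apply/funext => -[//|x] /=; rewrite aut_invK.
Qed.

Lemma solution_type_dense (p : S) : closure (range solution_type) p.
Proof.
move=> A /nbhs_typeP[s [sp sA]].
have [J [P [i [d s_inst]]]] := fset_instance s.
pose Sigma := [set psi : formula L (I + P) | p (instance id d psi)].
have Sigma_fin : finsat d Sigma.
  move=> q q_fin q_sub.
  have [||a aP] := @type_finsat _ _ _ _ p (instance id d @` q).
  - exact: finite_image.
  - by move=> _ [psi /q_sub ? <-].
  exists a => psi qpsi; have := aP (instance id d psi) (imageP _ qpsi).
  by rewrite /= sat_rename; congr (sat _ psi); apply/funext => -[].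
have [a aP] := saturated_realize C_sat (card_le_add_countType P I) Sigma_fin.
have a_pi psi : pi psi -> sat a psi.
  move=> pi_psi; have := aP (rename inl psi); rewrite /= sat_rename; apply.
  by rewrite /Sigma /= /instance rename_comp; exact: type_extends.
exists (solution_type (exist _ a a_pi)); split.
  by exists (exist _ a a_pi).
apply: sA => psi psis; have [psi' psiE] := s_inst psi psis.
have psiE' : psi = instance id d (rename (assign (inl \o i) inr) psi').
  by rewrite psiE -(instance_comp id d i id).
rewrite psiE'; apply/realized_instance; apply: aP.
by rewrite /Sigma /= -psiE'; exact: sp.
Qed.

Lemma lifted_type_flattening : fibre_flattening R phi' r lifted_type.
Proof.
move=> f s e f_cts e0.
have [J [P [i [d' f_det]]]] := finite_determination f_cts e0.
pose entries (x : (s * J)%type) : C := sval (val x.1) (i x.2).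
have [d dP] := reflect_tuple d' entries.
have [|g gP] := @homogeneous_countable C' _ (assign (j \o entries) d')
    (assign (j \o entries) (j \o d)) C'_hom.
  move=> psi; rewrite -dP (elementary_sat _ _ j_elem).
  rewrite (_ : j \o assign entries d = assign (j \o entries) (j \o d))//.
  by apply/funext => -[].
have gd : g \o d' = j \o d.
  by apply/funext => k; exact: (congr1 (@^~ (inr k)) gP).
have g_entries x : g (j (entries x)) = j (entries x).
  exact: (congr1 (@^~ (inl x)) gP).
exists g; split=> [z zs|p' q' pq]; apply: f_det => psi.
  rewrite type_actV_instance !realized_instance -[X in _ <-> X](sat_aut g).
  rewrite (_ : g \o _ = assign (j \o sval z \o i) (g \o d'))//.
  apply/funext => -[k|//] /=; exact: (g_entries ([` zs]%fset, k)).
by rewrite !type_actV_instance gd -!(type_restr_instance j_elem) pq.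
Qed.

Lemma lifted_type_imitation :
  action_imitation R phi' lifted_type solution_act.
Proof.
move=> f g s e f_cts e0.
have [J [P [i [d' f_det]]]] := finite_determination f_cts e0.
pose entries (x : (s * J)%type) : C := sval (val x.1) (i x.2).
have [|g' gP] := @homogeneous_countable C' _ (j \o ((g^-1)%g \o entries))
    (j \o entries) C'_hom.
  by move=> psi; rewrite -!(elementary_sat _ _ j_elem) sat_aut.
exists g' => z zs; apply: f_det => psi.
rewrite type_actV_instance !realized_instance -[X in _ <-> X](sat_aut g').
rewrite (_ : g' \o _ = assign (j \o sval z \o i) (g' \o d'))//.
apply/funext => -[k|//]; exact: (congr1 (@^~ ([` zs]%fset, k)) gP).
Qed.

Lemma solution_type_imitation :
  orbit_imitation R phi phi' r solution_type lifted_type.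
Proof.
move=> f s' s e f_cts e0.
have [J [P [i [c f_det]]]] := finite_determination f_cts e0.
pose entries (x : (s * J)%type) : C := sval (val x.1) (i x.2).
pose d' := aut_inv s' \o (j \o c).
have [d dP] := reflect_tuple d' entries.
have [|g gc] := @homogeneous_countable C _ c d C_hom.
  move=> psi; have := dP (rename inr psi); rewrite !sat_rename => ->.
  rewrite (elementary_sat _ _ j_elem) -[X in _ <-> X](sat_aut s').
  by rewrite (_ : s' \o d' = j \o c)//; apply/funext => n /=; rewrite aut_invK.
exists g => z zs; apply: f_det => psi.
rewrite type_actV_instance gc type_restr_instance type_act_instance.
rewrite !realized_instance.
pose at_z k : (s * J)%type := ([` zs]%fset, k).
have := dP (rename (assign (inl \o at_z) inr) psi); rewrite !sat_rename.
by congr iff; congr (sat _ psi); apply/funext => -[].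
Qed.

Lemma type_restr_surj (p : S) : exists p', r p' = p.
Proof.
have [p' _ <-] := lift_closure_surj (@type_space_hausdorff _ _ _ _)
  (@type_space_compact _ _ _ _) (@type_restr_continuous _ _ _ _ j_elem I pi)
  restr_lifted_type solution_type_dense p.
by exists p'.
Qed.

Lemma transfer_determined_function (f' : S' -> R) (c' : nat -> C')
    (c : nat -> C) :
  (forall p' q', agree_over id c' p' q' -> f' p' = f' q') ->
  (forall psi : formula L nat, sat c psi <-> sat c' psi) ->
  exists f : S -> R, forall (p : S) (p' : S'),
    (forall psi, p (instance id c psi) <-> p' (instance id c' psi)) ->
    f p = f' p'.
Proof.
move=> f'_det cc'.
have [|s' sc'] := @homogeneous_countable C' _ c' (j \o c) C'_hom.
  by move=> psi; rewrite -(elementary_sat _ _ j_elem) cc'.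
have /choice[up up_restr] := type_restr_surj.
exists (fun p => f' (phi' s'^-1%g (up p))) => p p' pp'; apply: f'_det => psi.
by rewrite type_actV_instance sc' -(type_restr_instance j_elem) up_restr.
Qed.

Lemma type_restr_reflection : countable_reflection R phi phi' r.
Proof.
move=> f' f'_cts; have [c' f'_det] := countable_determination f'_cts.
have [c cc'] := reflect_plain c'.
have [f fP] := transfer_determined_function f'_det cc'.
have [|s' sc'] := @homogeneous_countable C' _ c' (j \o c) C'_hom.
  by move=> psi; rewrite -(elementary_sat _ _ j_elem) cc'.
exists s', f; split=> [p'|g'].
  apply/esym/fP => psi; rewrite type_restr_instance type_act_instance -sc'.
  rewrite (_ : aut_inv s' \o _ = c')//.
  by apply/funext => n /=; rewrite aut_funK.
pose d' (x : nat * nat) := g' x.1 (c' x.2).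
have [d dd'] := reflect_plain d'.
have [|t td'] := @homogeneous_countable C' _ d' (j \o d) C'_hom.
  by move=> psi; rewrite -(elementary_sat _ _ j_elem) dd'.
have /choice[g gc] : forall n, exists g : aut C, g \o c = fun m => d (n, m).
  move=> n; apply: homogeneous_countable => // psi.
  have := dd' (rename (pair n) psi); rewrite !sat_rename => ->.
  by rewrite cc' -(sat_aut (g' n)).
exists g, (fun p' => r (phi' t p')) => n p'; apply/esym/fP => psi.
rewrite type_actV_instance gc type_restr_instance type_act_instance.
rewrite type_actV_instance (_ : aut_inv t \o _ = g' n \o c')//.
by apply/funext => m /=; rewrite -[j _]/((j \o d) (n, m)) -td' /= aut_funK.
Qed.

End elementary_pair.

Theorem theorem6p27 (R : realType) (L : language) (T : set (sentence L))
    (C C' : structure L) (j : C -> C')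
    (I : Type) (pi : set (formula L I)) (X : set (I -> C))
    (F : equiv_rel (type_space C pi)) (F' : equiv_rel (type_space C' pi))
    (T_complete : complete_theory T) (C_model : models C T)
    (C'_model : models C' T) (j_elem : elementary j)
    (C_sat : succ_saturated C (nat + I))
    (C'_sat : succ_saturated C' (nat + I))
    (C_hom : succ_strongly_homogeneous C (nat + I))
    (C'_hom : succ_strongly_homogeneous C' (nat + I))
    (X_def : type_defines pi X)
    (F_WAP : is_F_WAP R (type_flow C pi) F)
    (F'_WAP : is_F_WAP R (type_flow C' pi) F') :
  [set (type_restr j_elem ab.1, type_restr j_elem ab.2)
     | ab in [set ab | F' ab.1 ab.2]]
  = [set ab | F ab.1 ab.2].
Proof.
have S_compact := @type_space_compact L C I pi.
have S'_compact := @type_space_compact L C' I pi.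
have S_haus := @type_space_hausdorff L C I pi.
have S'_haus := @type_space_hausdorff L C' I pi.
have restr_cts := @type_restr_continuous L C C' j j_elem I pi.
have lifted := @restr_lifted_type L C C' j I pi j_elem.
have dense := @solution_type_dense L C I pi C_sat.
apply/seteqP; split=> [_ [[p' q'] /= pq <-]|[p q] /= pq].
  apply: (F_WAP_restrict S_compact S_haus S'_compact restr_cts lifted dense
    _ _ F_WAP.1 F'_WAP pq).
    exact: solution_type_imitation.
  exact: type_restr_reflection.
have [||p' [q' [p'q' <- <-]]] := F_WAP_lift S_compact S_haus S'_compact
    restr_cts lifted dense S'_haus (@act_solution_type L C I pi) _ _
    F'_WAP.1 F_WAP pq.
- exact: lifted_type_flattening.
- exact: lifted_type_imitation.
by exists (p', q').
Qed.
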